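(* Let $X$ be a connected $d$-complex ($d\ge2$), and let $Q\in\mathbb{N}$, $\lambda\in[-1,1]$, $\kappa\in[1,2]$ be such that (1) every $0$-face of $X$ lies in exactly $Q$ edges; (2) the underlying weighted graph of $X_v$ is a $[-1,\lambda]$-spectral expander for every $v\in X(0)$; (3) $\kappa^{-1}w(e)\le w(e')\le\kappa w(e)$ for all edges $e,e'$ sharing a vertex. Let $0<r<m$ be integers with $\frac{\kappa}{Q}<\frac rm<\frac2Q$. Let $\mathbb{F}$ be a finite field, $\mathcal{F}$ a locally constant $\mathbb{F}$-sheaf on $X$ of dimension $m$, and for each $e\in X(1)$ let $U(e)\subseteq\mathcal{F}(e)$ be an $(m-r)$-dimensional subspace such that (4) for every $v\in X(0)$ and every set $S$ of edges containing $v$ with $|S|r\ge m$, $\bigcap_{e\in S}\mathrm{res}_{e\leftarrow v}^{-1}U(e)=0$. Let $\mathcal{G}$ be the subsheaf of $\mathcal{F}$ with $\mathcal{G}(v)=0$ for $v\in X(0)$, $\mathcal{G}(e)=U(e)$ for $e\in X(1)$, and $\mathcal{G}(x)=\mathcal{F}(x)$ for $\dim x>1$. Suppose \[ \lambda\le\min\Big\{\tfrac16\Big(\tfrac14(1-\lambda)\big(1-\tfrac{\kappa/Q}{r/m}\big)-\lambda\Big)^2(1-\lambda),\ \tfrac14(1-\lambda)\big(1-\tfrac{\kappa/Q}{r/m}\big)\Big\}. \] Then there is $\delta>0$, depending on $Q,\lambda,r,m,\kappa$ and $D(X)$, such that the $1$-cocycle code associated to $(X,\mathcal{G})$ has relative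 distance $\ge\delta$; moreover its rate is at least $\frac2Q-\frac rm-|X(1)|^{-1}$.
   Context: A $d$-complex is a finite simplicial complex (faces include $\emptyset$) with every face in a $d$-face; $X(i)$ = $i$-faces; $D(X)$ = maximal number of $d$-faces containing a vertex; link $X_v=\{x\setminus v:v\subseteq x\in X\}$. Canonical weight $w(x)=\binom{d+1}{k+1}^{-1}|X(d)|^{-1}|\{y\in X(d):y\supseteq x\}|$ for $x\in X(k)$ (for a link, computed within the link). The weighted adjacency operator of a complex acts on $f:X(0)\to\mathbb{R}$ by $(\mathcal{A}f)(x)=\sum_{e\supseteq x}\frac{w(e)}{2w(x)}f(e\setminus x)$; the underlying weighted graph is a $[-1,\lambda]$-spectral expander if the spectrum of $\mathcal{A}$ on functions with $\sum f=0$ lies in $[-1,\lambda]$. An $\mathbb{F}$-sheaf assigns $\mathbb{F}$-spaces to nonempty faces with linear restriction maps compatible under composition; locally constant of dimension $m$ means all restriction maps are isomorphisms and all spaces have dimension $m$; a subsheaf is a family of subspaces preserved by restrictions (here $\mathcal{G}$ is a subsheaf since restrictions of $\mathcal{F}$ land in $\mathcal{F}(x)$ for $\dim x\ge2$). Cochains: after fixing a vertex order, $C^1(X,\mathcal{G})=\prod_{e\in X(1)}\mathcal{G}(e)$, and $Z^1(X,\mathcal{G})$ is the kernel of the signed coboundary $d_1$. The $1$-cocycle code is $Z^1(X,\mathcal{G})$ viewed inside $\Sigma^{X(1)}$, $\Sigma=\mathbb{F}^{m-r}$, via identifications $\mathcal{G}(e)\cong\Sigma$; its rate is $\dim Z^1/\dim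 C^1$ and its relative distance is the minimal fraction of edges on which a nonzero codeword is nonzero.
   Formalization: In the definition of a spectral expander, the zero-sum condition is taken with respect to the weights, Σ w(x)f(x)=0 instead of Σ f(x)=0, because the unweighted zero-sum functions are not stable under the adjacency operator when the vertex weights are not constant. *)

(* Defs.v *)
From HB Require Import structures.
From mathcomp Require Import all_boot all_order all_algebra.
From mathcomp Require Import reals.

Set Implicit Arguments.
Unset Strict Implicit.
Unset Printing Implicit Defensive.

Import Order.TTheory GRing.Theory Num.Theory.
Local Open Scope ring_scope.

(* MathComp equips {ffun I -> W} with a vectType structure only for constant W;
   cochains need the product of a family of spaces. *)
Section DepProduct.
Import VectorInternalTheory.
Variables (K : fieldType) (I : finType) (W : I -> vectType K).

Definition dprodv := {dffun forall i, W i}.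

HB.instance Definition _ := Choice.on dprodv.

Let zero : dprodv := [ffun i => 0].
Let opp (f : dprodv) : dprodv := [ffun i => - f i].
Let add (f g : dprodv) : dprodv := [ffun i => f i + g i].
Let scale (a : K) (f : dprodv) : dprodv := [ffun i => a *: f i].

Fact dprodv_addA : associative add.
Proof. by move=> f g h; apply/ffunP=> i; rewrite !ffunE addrA. Qed.
Fact dprodv_addC : commutative add.
Proof. by move=> f g; apply/ffunP=> i; rewrite !ffunE addrC. Qed.
Fact dprodv_add0 : left_id zero add.
Proof. by move=> f; apply/ffunP=> i; rewrite !ffunE add0r. Qed.
Fact dprodv_addN : left_inverse zero opp add.
Proof. by move=> f; apply/ffunP=> i; rewrite !ffunE addNr. Qed.

HB.instance Definition _ :=
  GRing.isZmodule.Build dprodv dprodv_addA dprodv_addC dprodv_add0 dprodv_addN.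

Fact dprodv_scaleA a b f : scale a (scale b f) = scale (a * b) f.
Proof. by apply/ffunP=> i; rewrite !ffunE scalerA. Qed.
Fact dprodv_scale1 : left_id 1 scale.
Proof. by move=> f; apply/ffunP=> i; rewrite !ffunE scale1r. Qed.
Fact dprodv_scaleDr : right_distributive scale +%R.
Proof. by move=> a f g; apply/ffunP=> i; rewrite !ffunE scalerDr. Qed.
Fact dprodv_scaleDl f : {morph scale^~ f : a b / a + b}.
Proof. by move=> a b; apply/ffunP=> i; rewrite !ffunE scalerDl. Qed.

HB.instance Definition _ := GRing.Zmodule_isLmodule.Build K dprodv
  dprodv_scaleA dprodv_scale1 dprodv_scaleDr dprodv_scaleDl.

Lemma dprodvP (f g : dprodv) : (forall i, f i = g i) <-> f = g.
Proof. exact: ffunP. Qed.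
Lemma dprodv0E i : (0 : dprodv) i = 0. Proof. exact: ffunE. Qed.
Lemma dprodvDE (f g : dprodv) i : (f + g) i = f i + g i.
Proof. exact: ffunE. Qed.
Lemma dprodvZE a (f : dprodv) i : (a *: f) i = a *: f i.
Proof. exact: ffunE. Qed.

Fact dprodv_vect_iso :
  Vector.axiom #|{: {i : I & 'I_(dim (W i))}}| dprodv.
Proof.
pose T := {i : I & 'I_(dim (W i))}.
pose fr (f : dprodv) : 'rV[K]_#|{: T}| :=
  \row_k v2r (f (tag (enum_val k))) 0 (tagged (enum_val k)).
exists fr.
  by move=> a f g; apply/rowP=> k; rewrite !mxE dprodvDE dprodvZE linearP !mxE.
pose rf (r : 'rV[K]_#|{: T}|) : dprodv :=
  [ffun i => r2v (\row_j r 0 (enum_rank (Tagged (fun i => 'I_(dim (W i))) j)))].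
exists rf => [f|r].
  apply/ffunP=> i; rewrite ffunE -[RHS]v2rK; congr r2v.
  by apply/rowP=> j; rewrite !mxE enum_rankK.
apply/rowP=> k; rewrite !mxE ffunE r2vK mxE; congr (r 0 _).
by rewrite taggedK enum_valK.
Qed.

HB.instance Definition _ := Lmodule_hasFinDim.Build K dprodv dprodv_vect_iso.

End DepProduct.

Section Complexes.
Variable V : finType.
Implicit Types (X : {set {set V}}) (x y z : {set V}).

Definition d_complex (d : nat) X : Prop :=
  [/\ set0 \in X,
      forall x y, y \in X -> x \subset y -> x \in X
    & forall x, x \in X -> exists2 y, y \in X & (#|y| == d.+1) && (x \subset y)].

Definition faces X (k : nat) : {set {set V}} := [set x in X | #|x| == k.+1].

Definition face X k : predArgType := {x : {set V} | x \in faces X k}.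
HB.instance Definition _ X k := SubType.on (face X k).
HB.instance Definition _ X k := Finite.on (face X k).

Definition cofaces X k x : {set {set V}} := [set y in faces X k | x \subset y].

Definition maxdeg d X : nat := \max_(v in faces X 0) #|cofaces X d v|.

Definition link X z : {set {set V}} := [set x :\: z | x in X & z \subset x].

Definition adjacent X : rel V := fun u v => (u != v) && ([set u; v] \in X).

Definition connected_complex X : Prop :=
  forall u v, [set u] \in X -> [set v] \in X -> connect (adjacent X) u v.

Section Weights.
Variables (R : realType) (d : nat) (X : {set {set V}}).

Definition weight x : R :=
  'C(d.+1, #|x|)%:R^-1 * #|faces X d|%:R^-1 * #|cofaces X d x|%:R.

(* If X is a complex, then e :\: x is a vertex of X, and the default value of
   insubd is not used. *)
Definition adjacency (f : {ffun face X 0 -> R}) : {ffun face X 0 -> R} :=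
  [ffun x : face X 0 => \sum_(e : face X 1 | val x \subset val e)
     weight (val e) / (2 * weight (val x)) * f (insubd x (val e :\: val x))].

(* The zero-sum condition is taken with respect to the measure w on X(0), i.e.
   f is orthogonal to the constants for <f, g> = \sum_x w(x) f(x) g(x): this
   subspace is stable under the adjacency operator, which is self-adjoint for
   that inner product, so that its spectrum consists of real eigenvalues. *)
Definition zero_sum (f : {ffun face X 0 -> R}) : Prop :=
  \sum_x weight (val x) * f x = 0.

Definition spectral_expander (mu la : R) : Prop :=
  forall (a : R) (f : {ffun face X 0 -> R}),
    f != 0 -> zero_sum f -> adjacency f = [ffun x => a * f x] ->
    mu <= a <= la.

End Weights.

Definition nonempty_face X x := (x \in X) && (x != set0).

(* stalk and res are total functions; only their values on nonempty faces, and
   on pairs x \proper y of such faces, are meaningful.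
   res A x y is the restriction map res_{y <- x}. *)
Record sheaf (F : fieldType) X := Sheaf {
  stalk : {set V} -> vectType F;
  res : forall x y, 'Hom(stalk x, stalk y);
  res_comp : forall x y z,
    nonempty_face X x -> nonempty_face X y -> nonempty_face X z ->
    x \proper y -> y \proper z ->
    (res y z \o res x y)%VF = res x z
}.

Definition locally_constant (F : fieldType) X (A : sheaf F X) (m : nat) : Prop :=
  (forall x, nonempty_face X x -> \dim {: stalk A x} = m) /\
  (forall x y, nonempty_face X x -> nonempty_face X y -> x \proper y ->
     bijective (res A x y)).

Record subsheaf (F : fieldType) X (A : sheaf F X) := Subsheaf {
  subspace :> forall x, {vspace stalk A x};
  subspace_res : forall x y,
    nonempty_face X x -> nonempty_face X y -> x \proper y ->
    (res A x y @: subspace x <= subspace y)%VS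
}.

Section SheafOfSubsheaf.
Variables (F : fieldType) (X : {set {set V}}) (A : sheaf F X).
Variable B : subsheaf A.

Definition sub_res x y : 'Hom(subvs_of (B x), subvs_of (B y)) :=
  linfun (vsproj (B y) \o (res A x y \o vsval)).

Lemma sub_resE x y (u : subvs_of (B x)) :
  nonempty_face X x -> nonempty_face X y -> x \proper y ->
  vsval (sub_res x y u) = res A x y (vsval u).
Proof.
move=> Xx Xy xy; rewrite lfunE /= vsprojK //.
by apply: (subvP (subspace_res B Xx Xy xy)); apply/memv_img/subvsP.
Qed.

Fact sub_res_comp x y z :
  nonempty_face X x -> nonempty_face X y -> nonempty_face X z ->
  x \proper y -> y \proper z ->
  (sub_res y z \o sub_res x y)%VF = sub_res x z.
Proof.
move=> Xx Xy Xz xy yz; apply/lfunP=> u; apply: subvs_inj.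
rewrite lfunE /= !sub_resE //; last exact: proper_trans yz.
by rewrite -(res_comp A Xx Xy Xz xy yz) lfunE.
Qed.

Definition sheaf_of_subsheaf : sheaf F X :=
  @Sheaf F X (fun x => subvs_of (B x)) sub_res sub_res_comp.

End SheafOfSubsheaf.

Section EdgeSubsheaf.
Variables (F : fieldType) (X : {set {set V}}) (A : sheaf F X).
Variable U : forall e, {vspace stalk A e}.

(* Recall dim x = #|x| - 1; the value at x = set0 is irrelevant. *)
Definition edge_subspace x : {vspace stalk A x} :=
  if (#|x| <= 1)%N then 0%VS else if #|x| == 2 then U x else fullv.

Fact edge_subspace_res x y :
  nonempty_face X x -> nonempty_face X y -> x \proper y ->
  (res A x y @: edge_subspace x <= edge_subspace y)%VS.
Proof.
move=> _ _ /proper_card xy; rewrite /edge_subspace.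
have [_|x1] := leqP #|x| 1; first by rewrite limg0 sub0v.
have y2 := leq_ltn_trans x1 xy.
by rewrite leqNgt (ltnW y2) /= (gtn_eqF y2) subvf.
Qed.

Definition edge_subsheaf : subsheaf A := Subsheaf edge_subspace_res.

End EdgeSubsheaf.

End Complexes.

Section Cochains.
Variables (disp : Order.disp_t) (V : finOrderType disp).
Variables (F : fieldType) (X : {set {set V}}) (A : sheaf F X).

Definition cochain k : vectType F := dprodv (fun x : face X k => stalk A (val x)).

(* If y = {v_0 < ... < v_k} and x = y :\ v_i, then position x y = i. *)
Definition position (x y : {set V}) : nat :=
  #|[set u in y | [exists v in y :\: x, (u < v)%O]]|.

Definition coboundary_fun k (f : cochain k) : cochain k.+1 :=
  [ffun y : face X k.+1 => \sum_(x : face X k | val x \subset val y)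
     (-1) ^+ position (val x) (val y) *: res A (val x) (val y) (f x)].

Fact coboundary_fun_linear k : linear (@coboundary_fun k).
Proof.
move=> a f g; apply/dprodvP=> y; rewrite dprodvDE dprodvZE !ffunE scaler_sumr.
rewrite -big_split /=; apply: eq_bigr => x _.
by rewrite dprodvDE dprodvZE linearP scalerDr !scalerA mulrC.
Qed.

HB.instance Definition _ k := GRing.isLinear.Build F (cochain k) (cochain k.+1)
  _ (@coboundary_fun k) (@coboundary_fun_linear k).

Definition coboundary k : 'Hom(cochain k, cochain k.+1) :=
  linfun (@coboundary_fun k).

Definition cocycles k : {vspace cochain k} := lker (coboundary k).

Definition cocycle_rate (R : realType) k : R :=
  (\dim (cocycles k))%:R / (\dim {: cochain k})%:R.

Section Code.
Variables (k n : nat).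
Variable iota : forall x : face X k, 'Hom(stalk A (val x), 'rV[F]_n).

Definition identify (f : cochain k) : {ffun face X k -> 'rV[F]_n} :=
  [ffun x => iota x (f x)].

Fact identify_linear : linear identify.
Proof.
by move=> a f g; apply/ffunP=> x; rewrite !ffunE linearP.
Qed.

HB.instance Definition _ := GRing.isLinear.Build F (cochain k)
  {ffun face X k -> 'rV[F]_n} _ identify identify_linear.

Definition cocycle_code : {vspace {ffun face X k -> 'rV[F]_n}} :=
  (linfun identify @: cocycles k)%VS.

End Code.
End Cochains.

(* Every nonzero word has relative weight at most 1, so the default value 1 is
   only seen for the zero code. *)
Definition relative_distance (R : realType) (F : finFieldType) (I : finType)
    (n : nat) (C : {vspace {ffun I -> 'rV[F]_n}}) : R :=
  \big[Num.min/1]_(c : {ffun I -> 'rV[F]_n} | (c \in C) && (c != 0))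
    (#|[set i | c i != 0]|%:R / #|I|%:R).

(* Main.v *)
Require Import Defs.
From HB Require Import structures.
From mathcomp Require Import all_boot all_order all_algebra.
From mathcomp Require Import reals.
From mathcomp Require Import ring lra zify.
Import Order.TTheory GRing.Theory Num.Theory.
Local Open Scope ring_scope.

(* A cocycle [f] of [G] is a cocycle of [A] whose value on each edge [e] lies in
   [U e].  At a vertex [v] the values on the edges at [v], moved to the stalk of
   [v], label the vertices of the link, and an edge of the link joins different
   labels exactly when [f] does not vanish on it.  By general position a nonzero
   label occupies a proportion at most p = (kappa/Q)/(r/m) of the link, so
   spectral expansion bounds below, by (1 - lambda)(1 - p), the ratio between the
   mass of the support edges in the link and that of the support edges at [v].

   Call [v] heavy when the support occupies more than a proportion eta of its
   edges.  At light vertices few triangles have both edges in the support, at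
   heavy ones the label expansion applies; counting triangles by their heavy
   vertices and support edges shows that edges joining two heavy vertices carry a
   fixed proportion of the mass of the support.  Trickling down makes the graph of
   [X] a lambda/(1 - lambda)-expander, so this is impossible for sparse supports.

   The rate follows by counting dimensions: the 0-cochains of [A] give a space of
   1-cocycles of dimension at least (|X(0)| - 1) m, and each edge condition costs
   [r] dimensions. *)

Set Implicit Arguments.
Unset Strict Implicit.
Unset Printing Implicit Defensive.

(** * Rayleigh bounds *)

Section TopEigenvalue.
Variable R : realType.

Definition dotv n (u v : 'rV[R]_n) : R := \sum_i u 0 i * v 0 i.

Lemma dotvE n (u v : 'rV[R]_n) : dotv u v = (u *m v^T) 0 0.
Proof. by rewrite mxE; apply: eq_bigr => i _; rewrite mxE. Qed.

Lemma dotv_ge0 n (u : 'rV[R]_n) : 0 <= dotv u u.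
Proof. by apply: sumr_ge0 => i _; rewrite -expr2 sqr_ge0. Qed.

Lemma dotv_eq0 n (u : 'rV[R]_n) : dotv u u = 0 -> u = 0.
Proof.
move=> h; apply/rowP => i; rewrite mxE.
have /eqP := h; rewrite psumr_eq0 => [/allP/(_ i)|j _]; last by rewrite -expr2 sqr_ge0.
by rewrite mem_index_enum => /(_ isT); rewrite -expr2 sqrf_eq0 => /eqP.
Qed.

(** Every square [u i ^+ 2] is at most [dotv u u], hence so is every [|u i * u j|]. This crude bound
    gives the existence of Rayleigh bounds and finite operator norms. *)
Lemma quad_le_dotv n (K : 'M[R]_n) (u : 'rV[R]_n) :
  dotv (u *m K) u <= (\sum_i \sum_j `|K i j|) * dotv u u.
Proof.
have hu i : u 0 i ^+ 2 <= dotv u u.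
  rewrite /dotv (bigD1 i) //= -expr2 lerDl; apply: sumr_ge0 => j _.
  by rewrite -expr2 sqr_ge0.
rewrite exchange_big mulr_suml; apply: ler_sum => j _.
rewrite mxE !mulr_suml; apply: ler_sum => i _.
apply: le_trans (ler_norm _) _; rewrite !normrM mulrAC mulrC.
rewrite ler_wpM2l // -!normrM.
have := hu i; have := hu j; have := sqr_ge0 (u 0 i - u 0 j).
have := sqr_ge0 (u 0 i + u 0 j).
by rewrite ler_norml => *; apply/andP; split; nra.
Qed.

Lemma dotvC n (u v : 'rV[R]_n) : dotv u v = dotv v u.
Proof. by apply: eq_bigr => i _; rewrite mulrC. Qed.

Lemma dotv_mulmx n (u v : 'rV[R]_n) (K : 'M[R]_n) :
  dotv (u *m K) v = dotv u (v *m K^T).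
Proof. by rewrite !dotvE trmx_mul trmxK mulmxA. Qed.

Lemma dotvDl n (u v w : 'rV[R]_n) : dotv (u + v) w = dotv u w + dotv v w.
Proof. by rewrite -big_split; apply: eq_bigr => i _; rewrite mxE mulrDl. Qed.

Lemma dotvZl n a (u w : 'rV[R]_n) : dotv (a *: u) w = a * dotv u w.
Proof. by rewrite mulr_sumr; apply: eq_bigr => i _; rewrite mxE mulrA. Qed.

Lemma psd_cauchy_schwarz n (P : 'M[R]_n) (u v : 'rV[R]_n) :
  P^T = P -> (forall x, 0 <= dotv (x *m P) x) ->
  dotv (u *m P) v ^+ 2 <= dotv (u *m P) u * dotv (v *m P) v.
Proof.
move=> PT Ppos.
have E a b : dotv ((a *: u + b *: v) *m P) (a *: u + b *: v) =
    a ^+ 2 * dotv (u *m P) u + 2 * a * b * dotv (u *m P) v + b ^+ 2 * dotv (v *m P) v.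
  rewrite mulmxDl -!scalemxAl dotvDl !dotvZl ![dotv (_ *m P) (_ + _)]dotvC.
  rewrite !dotvDl !dotvZl ![dotv _ (_ *m P)]dotvC.
  by rewrite [dotv (v *m P) u]dotv_mulmx PT [dotv v _]dotvC; ring.
have hu := Ppos u; have hv := Ppos v.
(* With [x], [y], [z] the values of the form at (u,u), (u,v), (v,v), the first two test vectors give
   [z * (x * z - y ^+ 2) >= 0] and [x * (x * z - y ^+ 2) >= 0]. The other two force [y = 0] when [x]
   and [z] both vanish. *)
have := Ppos (dotv (v *m P) v *: u + (- dotv (u *m P) v) *: v); rewrite E.
have := Ppos (- dotv (u *m P) v *: u + (dotv (u *m P) u) *: v); rewrite E.
have := Ppos (1 *: u + 1 *: v); rewrite E.
have := Ppos (1 *: u + (-1) *: v); rewrite E.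
move: hu hv; set x := dotv (u *m P) u.
set y := dotv (u *m P) v; set z := dotv (v *m P) v.
move=> hx hz h1 h2 h3 h4.
have [x0|x0] := ltrP 0 x.
  have : 0 <= x * (x * z - y ^+ 2) by lra.
  by rewrite pmulr_rge0 // subr_ge0.
have [z0|z0] := ltrP 0 z.
  have : 0 <= z * (x * z - y ^+ 2) by lra.
  by rewrite pmulr_rge0 // subr_ge0.
have -> : y = 0 by lra.
by rewrite expr0n mulr_ge0.
Qed.

(* The least Rayleigh bound [a] makes [a - K] positive semidefinite; were it
   invertible, Cauchy-Schwarz would bound it below by a positive multiple of the
   identity, contradicting minimality. *)
Lemma sym_top_eigenvector n (K : 'M[R]_n.+1) : K^T = K ->
  exists a : R, exists2 u : 'rV[R]_n.+1, u != 0 &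
    u *m K = a *: u /\ forall g, dotv (g *m K) g <= a * dotv g g.
Proof.
move=> KT.
pose B (c : R) := forall g : 'rV[R]_n.+1, dotv (g *m K) g <= c * dotv g g.
have B0 : classical_sets.nonempty B by exists (\sum_i \sum_j `|K i j|) => g; exact: quad_le_dotv.
have lbB (g : 'rV[R]_n.+1) : 0 < dotv g g -> classical_sets.lbound B (dotv (g *m K) g / dotv g g).
  by move=> g0 c /(_ g); rewrite ler_pdivrMr.
have d1 : 0 < dotv (delta_mx 0 0 : 'rV[R]_n.+1) (delta_mx 0 0).
  rewrite lt_def dotv_ge0 andbT; apply/eqP => /dotv_eq0 /rowP /(_ 0).
  by rewrite !mxE !eqxx => /eqP; rewrite oner_eq0.
pose a := inf B.
have aB : B a.
  move=> g; have := dotv_ge0 g; rewrite le_eqVlt => /predU1P [/esym/dotv_eq0 ->|g0].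
    by rewrite mul0mx /dotv big1 ?mulr0 // => i _; rewrite mxE mul0r.
  by rewrite -ler_pdivrMr //; apply: lb_le_inf => //; exact: lbB.
have amin c : B c -> a <= c.
  by move=> Bc; apply: ge_inf => //; exists (dotv (delta_mx 0 0 *m K) (delta_mx 0 0) / dotv (delta_mx 0 0 : 'rV[R]_n.+1) (delta_mx 0 0)); exact: lbB.
pose P := a%:M - K.
have PT : P^T = P by rewrite /P linearB /= tr_scalar_mx KT.
have PE g : dotv (g *m P) g = a * dotv g g - dotv (g *m K) g.
  rewrite /P mulmxBr mul_mx_scalar -scaleN1r dotvDl !dotvZl.
  by rewrite mulN1r.
have Ppos g : 0 <= dotv (g *m P) g by rewrite PE subr_ge0; exact: aB.
have [/det0P [u u0 uP]|dP] := boolP (\det P == 0).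
  exists a, u => //; split => //.
  by apply/esym/eqP; rewrite -subr_eq0 -mul_mx_scalar -mulmxBr uP.
have Pu : P \in unitmx by rewrite unitmxE unitfE.
(* [c2] bounds the form of [P] and [c3] the squared norm of its inverse. The added 1 keeps both
   positive. *)
pose c2 := 1 + \sum_i \sum_j `|P i j|.
pose c3 := 1 + \sum_i \sum_j `|(invmx P *m (invmx P)^T) i j|.
have bnd (A : 'M[R]_n.+1) : 0 < 1 + \sum_i \sum_j `|A i j|.
  by rewrite ltr_pwDl // sumr_ge0 // => i _; rewrite sumr_ge0.
have c20 : 0 < c2 by exact: bnd.
have c30 : 0 < c3 by exact: bnd.
(* Cauchy-Schwarz for [g] and [x = g *m P] bounds the norm of [x] by the form of [P] at [g].
   Applying the inverse of [P] to [x] recovers [g]. *)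
have main g : dotv g g <= c3 * c2 * dotv (g *m P) g.
  set x := g *m P.
  have h1 : dotv x x <= c2 * dotv x g.
    have cs := psd_cauchy_schwarz g x PT Ppos.
    have hx : dotv (x *m P) x <= c2 * dotv x x.
      by apply: le_trans (quad_le_dotv _ _) _; rewrite ler_wpM2r ?dotv_ge0 // lerDr.
    have := dotv_ge0 x; rewrite le_eqVlt => /predU1P [<-|x0].
      by apply: mulr_ge0; [exact: ltW | exact: Ppos].
    rewrite -(ler_pM2l x0) -expr2; apply: le_trans cs _.
    by rewrite mulrC mulrA [_ * c2]mulrC; apply: ler_wpM2r => //; exact: Ppos.
  have -> : dotv g g = dotv (x *m (invmx P *m (invmx P)^T)) x.
    by rewrite mulmxA dotv_mulmx trmxK /x mulmxK.
  apply: le_trans (quad_le_dotv _ _) _.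
  apply: (@le_trans _ _ (c3 * dotv x x)); first by rewrite ler_wpM2r ?dotv_ge0 // lerDr.
  by rewrite -mulrA ler_wpM2l // ltW.
have c0 : 0 < c3 * c2 by rewrite mulr_gt0.
have : B (a - (c3 * c2)^-1).
  move=> g; have := main g; rewrite PE -ler_pdivrMl // => ?; lra.
have : 0 < (c3 * c2)^-1 by rewrite invr_gt0.
by move=> ? /amin; lra.
Qed.

Lemma sym_top_eigenfunction (I : finType) (K : I -> I -> R) :
  (0 < #|I|)%N -> (forall i j, K i j = K j i) ->
  exists a : R, exists2 u : I -> R, (exists i, u i != 0) &
    (forall i, \sum_j K i j * u j = a * u i) /\
    forall g : I -> R, \sum_i \sum_j K i j * g i * g j <= a * \sum_i g i ^+ 2.
Proof.
move=> I0 Ksym; have [n In] : exists n, #|I| = n.+1 by case: #|I| I0 => // n _; exists n.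
pose ev (i : 'I_n.+1) : I := enum_val (cast_ord (esym In) i).
have evK : bijective ev.
  exists (cast_ord In \o enum_rank) => [i|i]; rewrite /ev /=.
    by rewrite enum_valK cast_ordKV.
  by rewrite cast_ordK enum_rankK.
have [ve evK1 evK2] := evK.
pose Km : 'M[R]_n.+1 := \matrix_(i, j) K (ev i) (ev j).
have KmT : Km^T = Km by apply/matrixP => i j; rewrite !mxE Ksym.
have [a [u u0 [uK aK]]] := sym_top_eigenvector KmT.
exists a, (fun i => u 0 (ve i)).
  have /rV0Pn [i ui] := u0; exists (ev i); by rewrite evK1.
split=> [i|g].
  have /rowP /(_ (ve i)) := uK; rewrite !mxE => <-.
  rewrite (reindex ev) /=; last exact: onW_bij.
  by apply: eq_bigr => j _; rewrite mxE evK1 evK2 mulrC Ksym.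
have := aK (\row_i g (ev i)).
have -> : dotv (\row_i g (ev i)) (\row_i g (ev i)) = \sum_i g i ^+ 2.
  rewrite (reindex ev) /=; last exact: onW_bij.
  by apply: eq_bigr => j _; rewrite !mxE expr2.
congr (_ <= _); rewrite exchange_big (reindex ev) /=; last exact: onW_bij.
apply: eq_bigr => j _; rewrite !mxE mulr_suml.
rewrite (reindex ev) /=; last exact: onW_bij.
by apply: eq_bigr => i _; rewrite !mxE; ring.
Qed.

(* Deflating the constants by [- 2 s s^T] moves their eigenvalue from 1 to -1,
   so the top eigenvector of the deflated matrix has zero sum. *)
Lemma weighted_rayleigh (I : finType) (w : I -> R) (M : I -> I -> R) (la : R) :
  0 <= la -> (forall i j, 0 <= M i j) -> (forall i j, M i j = M j i) ->
  (forall i, \sum_j M i j = w i) ->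
  (forall a (g : I -> R), (exists2 i, 0 < w i & g i != 0) -> \sum_i w i * g i = 0 ->
     (forall i, \sum_j M i j * g j = a * w i * g i) -> a <= la) ->
  forall g, \sum_i w i * g i = 0 ->
    \sum_i \sum_j M i j * g i * g j <= la * \sum_i w i * g i ^+ 2.
Proof.
move=> la0 M0 Msym Mw eig g g0.
have [I0|I0] := posnP #|I|.
  by rewrite !big1 ?mulr0 // => i; have := fintype0 i I0.
have w0 i : 0 <= w i by rewrite -Mw sumr_ge0.
have Mz i j : w i = 0 -> M i j = 0.
  move=> wi; have /eqP := Mw i; rewrite wi psumr_eq0 // => /allP /(_ j).
  by rewrite mem_index_enum => /(_ isT) /eqP.
(* Conjugating by the square roots of the weights turns the generalised eigenproblem for [M] and [w]
   into an ordinary symmetric one. Division by a zero [sw i] is harmless, since [Mz] makes the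
   matching row of [M] vanish. *)
pose sw i := Num.sqrt (w i).
have sw2 i : sw i * sw i = w i by rewrite -expr2 sqr_sqrtr.
have swz i : w i != 0 -> sw i != 0.
  by apply: contraNneq => si; rewrite -sw2 si mul0r.
have wz i : sw i = 0 -> w i = 0 by move=> si; rewrite -sw2 si mul0r.
pose N := \sum_i w i.
have N0 : 0 <= N by rewrite sumr_ge0.
pose s i := sw i / Num.sqrt N.
pose K i j := M i j / (sw i * sw j) - 2 * s i * s j.
have Ksym i j : K i j = K j i.
  by rewrite /K Msym [sw i * _]mulrC [2 * s i * s j]mulrAC.
have [a [u [i0 ui0] [uK aK]]] := sym_top_eigenfunction I0 Ksym.
have Msw i j h : M i j / (sw i * sw j) * (sw j * h) = M i j * h / sw i.
  have [wj|wj] := eqVneq (w j) 0; first by rewrite Msym Mz // !mul0r.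
  have [wi|wi] := eqVneq (w i) 0; first by rewrite Mz // !mul0r.
  by field; rewrite !swz.
(* At [sw i * g i] the deflating term is a multiple of the weighted sum of [g], hence zero, so [a]
   bounds the form on zero-sum functions. *)
suff ale : a <= la.
  have /le_trans := aK (fun i => sw i * g i).
  have -> : \sum_i (sw i * g i) ^+ 2 = \sum_i w i * g i ^+ 2.
    by apply: eq_bigr => i _; rewrite -sw2; ring.
  have -> : \sum_i \sum_j K i j * (sw i * g i) * (sw j * g j) =
            \sum_i \sum_j M i j * g i * g j.
    transitivity (\sum_i (\sum_j M i j * g i * g j -
        2 * s i * (sw i * g i) / Num.sqrt N * \sum_j w j * g j)).
      apply: eq_bigr => i _; rewrite mulr_sumr -sumrB; apply: eq_bigr => j _.
      rewrite /K 2!mulrBl mulrAC Msw; congr (_ - _).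
        have [wi|wi] := eqVneq (w i) 0; first by rewrite Mz // !mul0r.
        by field; rewrite swz.
      by rewrite /s -[w j]sw2; ring.
    by apply: eq_bigr => i _; rewrite g0 mulr0 subr0.
  apply; rewrite ler_wpM2r // sumr_ge0 // => i _.
  by rewrite mulr_ge0 // sqr_ge0.
(* Now [a > la >= 0]. Positivity of [a] forces [u] to vanish where [w] does, and separates [a] from
   the eigenvalue -1 of [s], so that [u] is orthogonal to [s] and the rescaled [u i / sw i] is an
   admissible eigenfunction. *)
rewrite leNgt; apply/negP => alt; have a0 : 0 < a by apply: le_lt_trans alt.
have uz i : w i = 0 -> u i = 0.
  move=> wi; have si : sw i = 0 by apply/eqP; rewrite sqrtr_eq0 wi.
  have /esym/eqP := uK i; rewrite big1 => [|j _]; last first.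
    by rewrite /K Mz // /s si !(mul0r, mulr0) subr0 mul0r.
  by rewrite mulf_eq0 (gt_eqF a0) => /eqP.
have Npos : 0 < N.
  have wi0 : w i0 != 0 by apply: contra ui0 => /eqP /uz ->.
  rewrite /N (bigD1 i0) //= ltr_pwDl ?sumr_ge0 // lt_def wi0 w0 //.
have sN : Num.sqrt N != 0 by rewrite gt_eqF // sqrtr_gt0.
have Ks i : \sum_j K i j * s j = - s i.
  transitivity ((\sum_j M i j) / sw i / Num.sqrt N - 2 * s i / (Num.sqrt N * Num.sqrt N) * \sum_j w j).
    rewrite mulr_sumr !mulr_suml -sumrB; apply: eq_bigr => j _.
    rewrite mulrBl [s j in X in X - _]/s Msw; congr (_ - _).
      by rewrite mulrAC.
    by rewrite /s -(sw2 j); field; exact: sN.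
  rewrite Mw -/N -expr2 sqr_sqrtr // /s; have [si|si] := eqVneq (sw i) 0.
    by rewrite wz // si !(mul0r, mulr0) oppr0 addr0.
  by rewrite -(sw2 i); field; rewrite (gt_eqF Npos) sN.
have c0 : \sum_i u i * s i = 0.
  have : a * \sum_i u i * s i = - \sum_i u i * s i.
    transitivity (\sum_i \sum_j K i j * u j * s i).
      by rewrite mulr_sumr; apply: eq_bigr => i _; rewrite -mulr_suml uK mulrA.
    rewrite exchange_big -sumrN; apply: eq_bigr => j _ /=.
    rewrite -mulrN -Ks mulr_sumr; apply: eq_bigr => i _.
    by rewrite Ksym; ring.
  by move: (\sum_i _) => c hc; apply/eqP; nra.
have : a <= la; last by rewrite leNgt alt.
apply: (eig a (fun i => u i / sw i)).
- exists i0; last by rewrite mulf_neq0 // invr_eq0 swz //; apply: contra ui0 => /eqP /uz ->.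
  by rewrite lt_def w0 andbT; apply: contra ui0 => /eqP /uz ->.
- transitivity (Num.sqrt N * \sum_i u i * s i); last by rewrite c0 mulr0.
  rewrite mulr_sumr; apply: eq_bigr => i _; rewrite /s.
  have [si|si] := eqVneq (sw i) 0; first by rewrite wz // si !(mul0r, mulr0).
  by rewrite -(sw2 i); field; rewrite si sN.
- move=> i; have [wi|wi] := eqVneq (w i) 0.
    by rewrite big1 => [|j _]; rewrite ?wi ?Mz // !(mul0r, mulr0).
  have -> : a * w i * (u i / sw i) = sw i * (a * u i).
    by rewrite -(sw2 i); field; exact: swz.
  rewrite -uK; transitivity (sw i * (\sum_j K i j * u j + 2 * s i * \sum_j u j * s j)).
    rewrite mulr_sumr -big_split mulr_sumr; apply: eq_bigr => j _ /=.
    have [wj|wj] := eqVneq (w j) 0; first by rewrite [M i j]Msym Mz // uz // !(mul0r, mulr0) addr0 mulr0.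
    by rewrite /K; field; rewrite !swz.
  by rewrite c0 mulr0 addr0.
Qed.

End TopEigenvalue.

(** * Means, vertex sets and labellings under a Rayleigh bound *)

Section RayleighBound.
Variables (R : realType) (I : finType) (w : I -> R) (M : I -> I -> R) (la : R).

(** The variational form of a bound on the nontrivial spectrum of a weighted graph with edge weights
    [M] and vertex weights [w]. It still makes sense when some weights vanish. *)
Definition rayleigh_bound : Prop :=
  forall g : I -> R, \sum_i w i * g i = 0 ->
    \sum_i \sum_j M i j * g i * g j <= la * \sum_i w i * g i ^+ 2.

Hypothesis Msym : forall i j, M i j = M j i.
Hypothesis Mw : forall i, \sum_j M i j = w i.
Hypothesis bound : rayleigh_bound.
Hypothesis wpos : 0 < \sum_i w i.

(** Subtracting the weighted mean [c] leaves a zero-sum function. The row sums of [M] make the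
    constant part contribute [c ^+ 2 * N] to both quadratic forms, whence the coefficient
    [1 - la]. *)
Lemma rayleigh_bound_mean (g : I -> R) :
  \sum_i \sum_j M i j * g i * g j <=
  la * \sum_i w i * g i ^+ 2 + (1 - la) * ((\sum_i w i * g i) ^+ 2 / \sum_i w i).
Proof.
set N := \sum_i w i; set s := \sum_i w i * g i; pose c := s / N.
have N0 : N != 0 by rewrite gt_eqF.
have sE : s = c * N by rewrite /c divfK.
have z : \sum_i w i * (g i - c) = 0.
  under eq_bigr do rewrite mulrBr.
  by rewrite sumrB -mulr_suml -/s -/N sE mulrC subrr.
have := bound z.
have -> : \sum_i w i * (g i - c) ^+ 2 = \sum_i w i * g i ^+ 2 - c ^+ 2 * N.
  transitivity (\sum_i w i * g i ^+ 2 - 2 * c * s + c ^+ 2 * N); last by rewrite sE; ring.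
  rewrite !mulr_sumr -sumrB -big_split; apply: eq_bigr => i _ /=; ring.
have -> : \sum_i \sum_j M i j * (g i - c) * (g j - c) =
          \sum_i \sum_j M i j * g i * g j - c ^+ 2 * N.
  have E1 : \sum_i \sum_j M i j * g i = s.
    by apply: eq_bigr => i _; rewrite -mulr_suml Mw.
  have E2 : \sum_i \sum_j M i j * g j = s.
    rewrite exchange_big -E1; apply: eq_bigr => i _; apply: eq_bigr => j _.
    by rewrite Msym.
  have E3 : \sum_i \sum_j M i j = N by apply: eq_bigr => i _.
  transitivity (\sum_i \sum_j M i j * g i * g j - c * s - c * s + c ^+ 2 * N); last first.
    by rewrite sE; ring.
  rewrite -{1}E1 -E2 -E3 !mulr_sumr -!sumrB -big_split; apply: eq_bigr => i _ /=.
  rewrite !mulr_sumr -!sumrB -big_split; apply: eq_bigr => j _ /=; ring.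
have -> : s ^+ 2 / N = c ^+ 2 * N by rewrite sE; field.
lra.
Qed.

(** The one-sided expander mixing bound for a vertex set: an indicator equals its own square. *)
Lemma rayleigh_bound_indicator (P : pred I) :
  \sum_i \sum_j M i j * (P i)%:R * (P j)%:R <=
  la * \sum_i w i * (P i)%:R + (1 - la) * ((\sum_i w i * (P i)%:R) ^+ 2 / \sum_i w i).
Proof.
have := rayleigh_bound_mean (fun i => (P i)%:R).
congr (_ <= la * _ + _); apply: eq_bigr => i _.
by case: (P i); rewrite ?expr1n ?expr0n.
Qed.

(** Outside [Z], each label class has proportion at most [p], so mixing leaves at most a fraction
    [la + (1 - la) * p] of its mass on edges inside the class. The complementary fraction
    [(1 - la) * (1 - p)] lies on edges joining different labels. *)
Lemma label_expansion (T : finType) (l : I -> T) (Z : pred T) (p : R) :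
  (forall i, 0 <= w i) -> (forall i j, 0 <= M i j) -> la <= 1 ->
  (forall c, ~~ Z c -> \sum_i w i * (l i == c)%:R <= p * \sum_i w i) ->
  (1 - la) * (1 - p) * \sum_i w i * (~~ Z (l i))%:R <=
  \sum_i \sum_j M i j * (l i != l j)%:R.
Proof.
move=> w0 M0 la1 hp.
set N := \sum_i w i; pose sc c := \sum_i w i * (l i == c)%:R.
have sc0 c : 0 <= sc c by apply: sumr_ge0 => i _; rewrite mulr_ge0.
have E i j : (~~ Z (l i))%:R * (l i == l j)%:R =
    \sum_(c | ~~ Z c) (l i == c)%:R * (l j == c)%:R :> R.
  rewrite big_mkcond (bigD1 (l i)) //= big1 => [|c cl]; last first.
    by rewrite [l i == c]eq_sym (negPf cl) mul0r if_same.
  by rewrite addr0 eqxx mul1r eq_sym; case: (Z _); rewrite ?mul0r ?mul1r.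
have -> : \sum_i w i * (~~ Z (l i))%:R = \sum_(c | ~~ Z c) sc c.
  rewrite exchange_big; apply: eq_bigr => i _; rewrite -mulr_sumr; congr (_ * _).
  by have := E i i; rewrite eqxx mulr1 => ->; apply: eq_bigr => c _; rewrite -natrM mulnb andbb.
have same : \sum_i \sum_j M i j * ((~~ Z (l i))%:R * (l i == l j)%:R) <=
    (la + (1 - la) * p) * \sum_(c | ~~ Z c) sc c.
  have -> : \sum_i \sum_j M i j * ((~~ Z (l i))%:R * (l i == l j)%:R) =
    \sum_(c | ~~ Z c) \sum_i \sum_j M i j * (l i == c)%:R * (l j == c)%:R.
    rewrite [RHS]exchange_big; apply: eq_bigr => i _; rewrite [RHS]exchange_big.
    apply: eq_bigr => j _; rewrite E mulr_sumr; apply: eq_bigr => c _; ring.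
  rewrite mulr_sumr; apply: ler_sum => c Zc.
  apply: le_trans (rayleigh_bound_indicator (fun i => l i == c)) _.
  rewrite -/(sc c) -/N [X in _ <= X]mulrDl lerD2l -[(1 - la) * p * _]mulrA ler_wpM2l ?subr_ge0 //.
  rewrite ler_pdivrMr // expr2 -mulrA [sc c * N]mulrC mulrA.
  by rewrite ler_wpM2r // hp.
have diff : \sum_i \sum_j M i j * (~~ Z (l i))%:R <=
    \sum_i \sum_j M i j * ((~~ Z (l i))%:R * (l i == l j)%:R) +
    \sum_i \sum_j M i j * (l i != l j)%:R.
  rewrite -big_split; apply: ler_sum => i _ /=; rewrite -big_split; apply: ler_sum => j _ /=.
  rewrite -mulrDr ler_wpM2l //.
  by case: (Z _); case: (l i == l j); rewrite /= ?mulr0 ?mulr1 ?addr0 ?add0r ?lexx ?ler01.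
have tot : \sum_i \sum_j M i j * (~~ Z (l i))%:R = \sum_(c | ~~ Z c) sc c.
  rewrite [RHS]exchange_big /=; apply: eq_bigr => i _.
  rewrite -mulr_suml Mw -mulr_sumr; congr (_ * _).
  by have := E i i; rewrite eqxx mulr1 => ->; apply: eq_bigr => c _; rewrite -natrM mulnb andbb.
rewrite tot in diff; lra.
Qed.

End RayleighBound.

(** * Weighted triples and trickling down *)

Section WeightedTriples.
Variables (R : realType) (V : finType) (t : V -> V -> V -> R).
Hypothesis t_ge0 : forall u v w, 0 <= t u v w.
Hypothesis tC12 : forall u v w, t u v w = t v u w.
Hypothesis tC23 : forall u v w, t u v w = t u w v.

(** All masses count ordered completions. The link of [v] is thus the graph with edge weights [t v]
    and vertex weights [edge_mass v], and the graph of the whole complex has [edge_mass] and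
    [vertex_mass] in these roles. *)
Definition edge_mass u v := \sum_w t u v w.
Definition vertex_mass u := \sum_v edge_mass u v.
Local Notation e := edge_mass.
Local Notation n := vertex_mass.

Lemma edge_mass_ge0 u v : 0 <= e u v.
Proof. by apply: sumr_ge0. Qed.

Lemma vertex_mass_ge0 u : 0 <= n u.
Proof. by apply: sumr_ge0 => v _; exact: edge_mass_ge0. Qed.

Lemma edge_massC u v : e u v = e v u.
Proof. by apply: eq_bigr => w _. Qed.

Lemma edge_mass0 u v w : e u v = 0 -> t u v w = 0.
Proof.
move=> /eqP; rewrite psumr_eq0 // => /allP /(_ w).
by rewrite mem_index_enum => /(_ isT) /eqP.
Qed.

Lemma vertex_mass0 u v : n u = 0 -> e u v = 0.
Proof.
move=> /eqP; rewrite psumr_eq0 => [/allP /(_ v)|w _]; last exact: edge_mass_ge0.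
by rewrite mem_index_enum => /(_ isT) /eqP.
Qed.

Section TricklingDown.
Variable la : R.
Hypothesis la01 : 0 <= la < 1.
Hypothesis link_bound : forall v, rayleigh_bound (e v) (t v) la.
Hypothesis conn : forall u v, 0 < n u -> 0 < n v -> connect (fun x y => 0 < e x y) u v.

(** An eigenfunction [g] is restricted to every link. The eigenvalue equation says that its mean
    over the link of [v] is [a * g v], so summing the link bounds gives
    [a <= la + (1 - la) * a ^+ 2]. Connectedness excludes [a = 1], and the other root is
    [la / (1 - la)]. *)
Lemma trickling_down : rayleigh_bound n e (la / (1 - la)).
Proof.
have [la0 la1] := andP la01.
have l1 : 0 < 1 - la by rewrite subr_gt0.
apply: weighted_rayleigh => //.
- by rewrite divr_ge0 // ltW.
- exact: edge_mass_ge0.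
- exact: edge_massC.
move=> a g [i0 ni0 gi0] gsum eig.
pose E := \sum_u n u * g u ^+ 2.
have E0 : 0 < E.
  rewrite /E (bigD1 i0) //= ltr_pwDl // ?sumr_ge0 //.
    by rewrite mulr_gt0 // lt_def sqrf_eq0 gi0 sqr_ge0.
  by move=> i _; rewrite mulr_ge0 ?sqr_ge0 // vertex_mass_ge0.
have qE : \sum_u \sum_w e u w * g u * g w = a * E.
  rewrite mulr_sumr; apply: eq_bigr => u _.
  have -> : a * (n u * g u ^+ 2) = a * n u * g u * g u by ring.
  rewrite -eig mulr_suml; apply: eq_bigr => w _; ring.
have sE : \sum_u \sum_w e u w * g w ^+ 2 = E.
  rewrite exchange_big; apply: eq_bigr => u _; rewrite -mulr_suml; congr (_ * _).
  by apply: eq_bigr => v _; exact: edge_massC.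
have sE' : \sum_u \sum_w e u w * g u ^+ 2 = E.
  by apply: eq_bigr => u _; rewrite -mulr_suml.
have dir : \sum_u \sum_w e u w * (g u - g w) ^+ 2 = 2 * (1 - a) * E.
  transitivity (E - 2 * (a * E) + E); last by ring.
  rewrite -qE -{1}sE' -sE mulr_sumr -sumrB -big_split; apply: eq_bigr => u _ /=.
  rewrite mulr_sumr -sumrB -big_split; apply: eq_bigr => w _ /=; ring.
have term0 u w : 0 <= e u w * (g u - g w) ^+ 2.
  by rewrite mulr_ge0 ?sqr_ge0 ?edge_mass_ge0.
have a1 : a < 1.
  rewrite lt_neqAle; apply/andP; split; last first.
    have : 0 <= 2 * (1 - a) * E.
      by rewrite -dir; apply: sumr_ge0 => u _; apply: sumr_ge0.
    by rewrite pmulr_lge0 // => ?; lra.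
  (* For [a = 1] the Dirichlet energy is zero, so [g] is constant along edges, hence on all vertices
     of positive mass; its zero sum then contradicts [g i0 != 0]. *)
  apply/eqP => a1; move: dir; rewrite a1 subrr mulr0 mul0r => dir.
  have loc u w : 0 < e u w -> g u = g w.
    move=> euw; have /eqP := dir; rewrite psumr_eq0 => [/allP /(_ u)|x _]; last exact: sumr_ge0.
    rewrite mem_index_enum => /(_ isT) /=; rewrite psumr_eq0 // => /allP /(_ w).
    rewrite mem_index_enum => /(_ isT) /=.
    by rewrite mulf_eq0 (gt_eqF euw) sqrf_eq0 subr_eq0 => /eqP.
  have glob u : 0 < n u -> g u = g i0.
    move=> nu; have /connectP [p pth ->] := conn nu ni0.
    elim: p {nu} u pth => //= y p IH u /andP [/loc -> /IH]; exact.
  have : g i0 * \sum_u n u = 0.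
    rewrite -[RHS]gsum mulr_sumr; apply: eq_bigr => u _.
    have := vertex_mass_ge0 u; rewrite le_eqVlt => /predU1P [<-|nu].
      by rewrite mulr0 mul0r.
    by rewrite glob // mulrC.
  apply/eqP; rewrite mulf_neq0 // gt_eqF // (bigD1 i0) //= ltr_pwDl //.
  by rewrite sumr_ge0 // => i _; exact: vertex_mass_ge0.
have key : a * E <= la * E + (1 - la) * (a ^+ 2 * E).
  have -> : a * E = \sum_v \sum_u \sum_w t v u w * g u * g w.
    rewrite -qE [RHS]exchange_big /=; apply: eq_bigr => u _.
    rewrite [RHS]exchange_big /=; apply: eq_bigr => w _.
    rewrite -!mulr_suml; congr (_ * _ * _).
    by apply: eq_bigr => v _; rewrite tC23 tC12.
  have -> : la * E + (1 - la) * (a ^+ 2 * E) = \sum_v (la * (\sum_u e v u * g u ^+ 2)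
      + (1 - la) * (a ^+ 2 * (n v * g v ^+ 2))).
    by rewrite big_split /= -!mulr_sumr sE.
  apply: ler_sum => v _ /=.
  have := vertex_mass_ge0 v; rewrite le_eqVlt => /predU1P [nv|nv].
    rewrite -nv !(mul0r, mulr0) addr0 !big1 ?mulr0 // => u _.
      by rewrite vertex_mass0 // mul0r.
    by rewrite big1 // => w _; rewrite edge_mass0 ?mul0r // vertex_mass0.
  have := rayleigh_bound_mean (tC23 v) (fun=> erefl) (@link_bound v) nv g.
  move=> /le_trans; apply.
  rewrite -/(n v) eig.
  have -> // : (a * n v * g v) ^+ 2 / n v = a ^+ 2 * (n v * g v ^+ 2).
  by field; rewrite gt_eqF.
(* The quadratic factors as [(1 - a) * (la - (1 - la) * a)], whose first factor is positive. *)
have : 0 <= (la + (1 - la) * a ^+ 2 - a) * E by lra.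
rewrite pmulr_lge0 // => h; rewrite ler_pdivlMr //; nra.
Qed.

End TricklingDown.

Definition triple_sum (phi : V -> V -> V -> R) :=
  \sum_v \sum_u \sum_w t v u w * phi v u w.

Lemma triple_sumC12 phi : triple_sum phi = triple_sum (fun v u w => phi u v w).
Proof.
rewrite /triple_sum exchange_big; apply: eq_bigr => u _; apply: eq_bigr => v _.
by apply: eq_bigr => w _; rewrite tC12.
Qed.

Lemma triple_sumC23 phi : triple_sum phi = triple_sum (fun v u w => phi v w u).
Proof.
apply: eq_bigr => v _; rewrite exchange_big; apply: eq_bigr => u _.
by apply: eq_bigr => w _; rewrite tC23.
Qed.

Lemma triple_sumD phi psi :
  triple_sum (fun v u w => phi v u w + psi v u w) = triple_sum phi + triple_sum psi.
Proof.
rewrite /triple_sum -big_split; apply: eq_bigr => v _ /=; rewrite -big_split.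
apply: eq_bigr => u _ /=; rewrite -big_split; apply: eq_bigr => w _ /=.
by rewrite mulrDr.
Qed.

Lemma triple_sumZ a phi :
  triple_sum (fun v u w => a * phi v u w) = a * triple_sum phi.
Proof.
rewrite /triple_sum mulr_sumr; apply: eq_bigr => v _ /=; rewrite mulr_sumr.
apply: eq_bigr => u _ /=; rewrite mulr_sumr; apply: eq_bigr => w _ /=.
by rewrite mulrCA.
Qed.

Definition symmetrization (phi : V -> V -> V -> R) v u w :=
  phi v u w + phi v w u + phi u v w + phi u w v + phi w v u + phi w u v.

Lemma triple_sum_symmetrization phi :
  triple_sum (symmetrization phi) = 6 * triple_sum phi.
Proof.
rewrite /symmetrization !triple_sumD.
have E1 : triple_sum (fun v u w => phi v w u) = triple_sum phi.
  by rewrite [RHS]triple_sumC23.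
have E2 : triple_sum (fun v u w => phi u v w) = triple_sum phi.
  by rewrite [RHS]triple_sumC12.
have E3 : triple_sum (fun v u w => phi u w v) = triple_sum phi.
  by rewrite triple_sumC12.
have E4 : triple_sum (fun v u w => phi w v u) = triple_sum phi.
  by rewrite triple_sumC23.
have E5 : triple_sum (fun v u w => phi w u v) = triple_sum phi.
  by rewrite triple_sumC23.
by rewrite -/(triple_sum phi) E1 E2 E3 E4 E5; ring.
Qed.

(** Since [t] is symmetric, a triple sum depends only on the symmetrization of its integrand, so
    integrands may be compared triangle by triangle after adding the six orderings. *)
Lemma le_triple_sum phi psi :
  (forall v u w, t v u w != 0 ->
     symmetrization phi v u w <= symmetrization psi v u w) ->
  triple_sum phi <= triple_sum psi.
Proof.
move=> h; rewrite -(@ler_pM2l _ 6) // -!triple_sum_symmetrization.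
apply: ler_sum => v _; apply: ler_sum => u _; apply: ler_sum => w _.
have [->|t0] := eqVneq (t v u w) 0; first by rewrite !mul0r.
by rewrite ler_wpM2l // h.
Qed.

(** * Counting triangles by heavy vertices and support edges *)

Section SparseSupport.
Variables (la eps eta : R) (S : rel V).
Hypothesis la01 : 0 <= la < 1.
Hypothesis eps01 : 0 < eps <= 1.
Hypothesis etaE : eta = eps / 4 - la.
Hypothesis eta_gt0 : 0 < eta.
Hypothesis la_eta : la / (1 - la) <= eta ^+ 2 / 6.
Hypothesis link_bound : forall v, rayleigh_bound (e v) (t v) la.
Hypothesis conn : forall u v, 0 < n u -> 0 < n v -> connect (fun x y => 0 < e x y) u v.
Hypothesis Ssym : symmetric S.
Hypothesis Stri : forall v u w, t v u w != 0 -> S v u -> S v w || S u w.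
Hypothesis Sexp : forall v,
  eps * \sum_u e v u * (S v u)%:R <= \sum_u \sum_w t v u w * (S u w)%:R.

Let heavy v := eta * n v < \sum_u e v u * (S v u)%:R.
Let W := \sum_v \sum_u e v u * (S v u)%:R.
(** Even the statistics that concern a single edge are written as sums over triangles, so that all
    five can be compared by [le_triple_sum]. *)
Let WH := triple_sum (fun v u w => (heavy v)%:R * (S v u)%:R).
Let WL := triple_sum (fun v u w => (~~ heavy v)%:R * (S v u)%:R).
Let EH := triple_sum (fun v u w => (heavy v)%:R * (S u w)%:R).
Let L2 := triple_sum (fun v u w => (~~ heavy v)%:R * ((S v u)%:R * (S v w)%:R)).
Let HH := triple_sum (fun v u w => (heavy v)%:R * (heavy u)%:R).

Let triple_sum_edge (c : V -> R) (f : V -> V -> R) :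
  triple_sum (fun v u w => c v * f v u) = \sum_v c v * \sum_u e v u * f v u.
Proof.
apply: eq_bigr => v _; rewrite mulr_sumr; apply: eq_bigr => u _.
by rewrite -mulr_suml mulrCA.
Qed.

Let triple_sum_vertex (c : V -> R) (f : V -> V -> V -> R) :
  triple_sum (fun v u w => c v * f v u w) =
  \sum_v c v * \sum_u \sum_w t v u w * f v u w.
Proof.
apply: eq_bigr => v _; rewrite mulr_sumr; apply: eq_bigr => u _.
by rewrite mulr_sumr; apply: eq_bigr => w _; rewrite mulrCA.
Qed.

Let W_split : W = WL + WH.
Proof.
rewrite /WL /WH !triple_sum_edge -big_split; apply: eq_bigr => v _ /=.
by case: (heavy v); rewrite ?(mul0r, mul1r, add0r, addr0).
Qed.

Let W_ge0 : 0 <= W.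
Proof.
apply: sumr_ge0 => v _; apply: sumr_ge0 => u _.
by rewrite mulr_ge0 ?edge_mass_ge0.
Qed.

(** At a light vertex the support has density at most [eta] in the link, so mixing gives the factor
    [la + eta], which is [eps / 4] by the choice of [eta]. *)
Let light_pairs : L2 <= eps / 4 * WL.
Proof.
rewrite /L2 /WL triple_sum_vertex triple_sum_edge mulr_sumr.
apply: ler_sum => v _; have [hv|hv] := boolP (heavy v).
  by rewrite !mul0r mulr0.
rewrite !mul1r.
set s := \sum_u e v u * (S v u)%:R.
have s0 : 0 <= s by apply: sumr_ge0 => u _; rewrite mulr_ge0 ?edge_mass_ge0.
have := vertex_mass_ge0 v; rewrite le_eqVlt => /predU1P [/esym nv|nv].
  have -> : s = 0 by apply: big1 => u _; rewrite vertex_mass0 // mul0r.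
  rewrite mulr0 big1 // => u _; rewrite big1 // => w _.
  by rewrite edge_mass0 ?mul0r // vertex_mass0.
have := rayleigh_bound_indicator (tC23 v) (fun=> erefl) (@link_bound v) nv (S v).
rewrite -/(n v) -/s => hb.
have -> : \sum_u \sum_w t v u w * ((S v u)%:R * (S v w)%:R) =
  \sum_u \sum_w t v u w * (S v u)%:R * (S v w)%:R.
  by apply: eq_bigr => u _; apply: eq_bigr => w _; rewrite mulrA.
apply: le_trans hb _.
have : s ^+ 2 / n v <= eta * s.
  rewrite ler_pdivrMr // expr2 mulrAC ler_wpM2r //.
  by rewrite leNgt.
have /andP [la0 la1] := la01.
have es : 0 <= eta * s by rewrite mulr_ge0 // ltW.
by move: etaE es; nra.
Qed.

Let heavy_links : eps * WH <= EH.
Proof.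
rewrite /EH /WH triple_sum_edge triple_sum_vertex mulr_sumr.
by apply: ler_sum => v _; rewrite mulrCA ler_wpM2l // Sexp.
Qed.

(* Averaging over the six orderings of a triangle turns this and the next bound
   into finite checks on which vertices are heavy and which edges in the support. *)
Let EH_le : EH <= 2 * L2 + HH.
Proof.
rewrite /EH /L2 /HH -triple_sumZ -triple_sumD; apply: le_triple_sum => v u w t0.
have tvwu : t v w u != 0 by rewrite -tC23.
have tuvw : t u v w != 0 by rewrite tC12.
(* These instances of [Stri] say that no triangle contains exactly one support edge, which removes
   the configurations where the inequality could fail. *)
have := Stri t0; have := Stri tvwu; have := Stri tuvw.
have := Stri (_ : t u w v != 0); rewrite -tC23 tuvw => /(_ isT).
rewrite /symmetrization (Ssym u v) (Ssym w v) (Ssym w u).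
case: (heavy v); case: (heavy u); case: (heavy w);
  case: (S v u); case: (S v w); case: (S u w) => //= h1 h2 h3 h4;
  (try by move: (h1 isT)); (try by move: (h2 isT)); (try by move: (h3 isT));
  (try by move: (h4 isT)); lra.
Qed.

Let WL_le : WL + EH <= 2 * L2 + WH.
Proof.
rewrite /EH /L2 /HH -triple_sumZ -!triple_sumD; apply: le_triple_sum => v u w t0.
have tvwu : t v w u != 0 by rewrite -tC23.
have tuvw : t u v w != 0 by rewrite tC12.
have := Stri t0; have := Stri tvwu; have := Stri tuvw.
have := Stri (_ : t u w v != 0); rewrite -tC23 tuvw => /(_ isT).
rewrite /symmetrization (Ssym u v) (Ssym w v) (Ssym w u).
case: (heavy v); case: (heavy u); case: (heavy w);
  case: (S v u); case: (S v w); case: (S u w) => //= h1 h2 h3 h4;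
  (try by move: (h1 isT)); (try by move: (h2 isT)); (try by move: (h3 isT));
  (try by move: (h4 isT)); lra.
Qed.

(** The triangle counts give [eps / 4 * W <= HH]. Mixing in the whole graph, with heavy mass at most
    [W / eta], gives [HH <= W * (eta / 6 + W / (eta ^+ 2 * N))]. Cancelling [W] and using
    [eta <= eps / 4] leaves [eps / 4 - eps / 24], that is [5 / 24 * eps]. *)
Lemma sparse_support_bound : W = 0 \/ 5 / 24 * eps * eta ^+ 2 * \sum_v n v <= W.
Proof.
have /andP [la0 la1] := la01; have /andP [e0 e1] := eps01.
have [W0|W0] := eqVneq W 0; [by left | right].
have Wp : 0 < W by rewrite lt_def W0 W_ge0.
set N := \sum_v n v.
have N0 : 0 <= N by apply: sumr_ge0 => v _; exact: vertex_mass_ge0.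
have Np : 0 < N.
  rewrite lt_def N0 andbT; apply: contra W0 => /eqP N00; apply/eqP.
  apply: big1 => v _; apply: big1 => u _; rewrite vertex_mass0 ?mul0r //.
  move/eqP: N00; rewrite psumr_eq0 => [/allP /(_ v)|x _]; last exact: vertex_mass_ge0.
  by rewrite mem_index_enum => /(_ isT) /eqP.
pose h := \sum_v n v * (heavy v)%:R.
have h0 : 0 <= h by apply: sumr_ge0 => v _; rewrite mulr_ge0 ?vertex_mass_ge0.
(* Markov's inequality for the support mass at a vertex. *)
have hW : eta * h <= W.
  rewrite W_split; apply: (@le_trans _ _ WH).
    rewrite /WH triple_sum_edge mulr_sumr; apply: ler_sum => v _.
    have [hv|hv] := boolP (heavy v); last by rewrite !(mulr0, mul0r).
    by rewrite mul1r mulr1 ltW.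
  rewrite lerDr; apply: sumr_ge0 => v _; apply: sumr_ge0 => u _; apply: sumr_ge0 => w _.
  by rewrite !mulr_ge0.
have HHle : HH <= la / (1 - la) * h + h ^+ 2 / N.
  have mu0 : 0 <= la / (1 - la) by rewrite divr_ge0 // subr_ge0 ltW.
  have := rayleigh_bound_indicator edge_massC (fun=> erefl)
    (trickling_down la01 link_bound conn) Np heavy.
  rewrite -/h -/N => hb.
  have -> : HH = \sum_i \sum_j e i j * (heavy i)%:R * (heavy j)%:R.
    by rewrite /HH triple_sum_edge; apply: eq_bigr => v _; rewrite mulr_sumr;
       apply: eq_bigr => u _; rewrite mulrCA mulrA.
  apply: le_trans hb _; rewrite lerD2l ler_piMl //; last by rewrite lerBlDr lerDl.
  by rewrite divr_ge0 // sqr_ge0.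
have eta_le : eta <= eps / 4 by move: etaE la0; lra.
have lower : eps / 4 * W <= HH.
  have WH0 : 0 <= WH.
    apply: sumr_ge0 => v _; apply: sumr_ge0 => u _; apply: sumr_ge0 => w _.
    by rewrite !mulr_ge0.
  (* [WL_le], [light_pairs] and [heavy_links] combine to [(1 - eps / 2) * WL <= (1 - eps) * WH]. *)
  have WLH : WL <= WH.
    have c0 : 0 < 1 - eps / 2 by lra.
    have eW : 0 <= eps * WH by rewrite mulr_ge0 // ltW.
    rewrite -(ler_pM2l c0); move: light_pairs heavy_links WL_le eW; lra.
  have eW : 0 <= eps * (WH - WL) by rewrite mulr_ge0 ?subr_ge0 // ltW.
  rewrite W_split; move: light_pairs heavy_links EH_le eW; lra.
have hle : h <= W / eta by rewrite ler_pdivlMr // mulrC.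
have step : eps / 4 * W <= W * (eta / 6 + W / (eta ^+ 2 * N)).
  apply: le_trans lower _; apply: le_trans HHle _.
  apply: (@le_trans _ _ (eta ^+ 2 / 6 * (W / eta) + (W / eta) ^+ 2 / N)).
    apply: lerD; first by apply: ler_pM => //; rewrite divr_ge0 // subr_ge0 ltW.
    rewrite ler_wpM2r ?invr_ge0 // ler_pXn2r // ?nnegrE //.
    by rewrite divr_ge0 // ltW.
  have -> // : eta ^+ 2 / 6 * (W / eta) + (W / eta) ^+ 2 / N =
    W * (eta / 6 + W / (eta ^+ 2 * N)).
  by field; rewrite !gt_eqF.
rewrite [_ * W]mulrC ler_pM2l // in step.
have : 5 / 24 * eps <= W / (eta ^+ 2 * N) by lra.
by rewrite ler_pdivlMr ?mulr_gt0 ?exprn_gt0 // mulrA.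
Qed.

End SparseSupport.

End WeightedTriples.

(** * Face counts and links *)

Section FaceSums.
Variables (V : finType) (T : zmodType) (X : {set {set V}}).

Lemma big_face k (P : pred {set V}) (G : {set V} -> T) :
  \sum_(x : face X k | P (val x)) G (val x) = \sum_(x in faces X k | P x) G x.
Proof.
rewrite [RHS](reindex_omap (val : face X k -> {set V}) insub) /=; last first.
  by move=> x /andP [xX _]; rewrite insubT.
apply: eq_bigl => x; rewrite valK eqxx andbT.
by rewrite (valP x).
Qed.

Lemma big_vertices (G : {set V} -> T) :
  \sum_(x : face X 0) G (val x) = \sum_(u | [set u] \in faces X 0) G [set u].
Proof.
rewrite (big_face 0 predT G) (eq_bigl (mem (faces X 0))) => [|x]; last by rewrite andbT.
rewrite (eq_bigl (mem ((@set1 V) @: [set u | [set u] \in faces X 0]))); last first.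
  move=> x /=; apply/idP/imsetP => [xX|[u]]; last by rewrite inE => ? ->.
  have := xX; rewrite inE => /andP [_ /cards1P [u xu]].
  by exists u => //; rewrite inE -xu.
rewrite big_imset /=; last by move=> u v _ _; exact: set1_inj.
by apply: eq_bigl => u; rewrite inE.
Qed.

Lemma set2_injr (u : V) : {in [set w | u != w] &, injective (fun w => [set u; w])}.
Proof.
move=> w w'; rewrite !inE => uw _ /setP /(_ w); rewrite !inE eqxx orbT.
by rewrite eq_sym (negPf uw) => /esym/eqP.
Qed.

Lemma set2_faces u w : [set u; w] \in faces X 1 -> u != w.
Proof.
by rewrite inE cards2 => /andP [_]; case: (u != w).
Qed.

Lemma coface1P (u : V) (x : {set V}) :
  reflect (exists2 w, [set u; w] \in faces X 1 & x = [set u; w]) (x \in cofaces X 1 [set u]).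
Proof.
rewrite inE; apply: (iffP andP) => [[xX]|[w wX ->]]; last by rewrite wX sub1set set21.
rewrite sub1set => ux; have := xX; rewrite inE => /andP [_ /cards2P [a [b [ab xE]]]].
move: ux; rewrite xE !inE => /orP [] /eqP uE; subst u.
  by exists b; rewrite -?xE.
by exists a; rewrite setUC -?xE.
Qed.

Lemma big_edges_at (u : V) (G : {set V} -> T) :
  \sum_(x : face X 1 | [set u] \subset val x) G (val x) =
  \sum_(w | [set u; w] \in faces X 1) G [set u; w].
Proof.
rewrite (big_face 1 (fun x => [set u] \subset x) G).
rewrite (eq_bigl (mem ((fun w => [set u; w]) @: [set w | [set u; w] \in faces X 1]))).
  rewrite big_imset /=; first by apply: eq_bigl => w; rewrite inE.
  move=> w w'; rewrite in_set => /set2_faces uw; rewrite in_set => /set2_faces uw'.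
  by apply: set2_injr; rewrite inE.
move=> x /=; have -> : (x \in faces X 1) && ([set u] \subset x) = (x \in cofaces X 1 [set u]).
  by rewrite [RHS]inE.
apply/coface1P/imsetP => [[w ? ->]|[w]]; first by exists w => //; rewrite in_set.
by rewrite in_set => ? ->; exists w.
Qed.

End FaceSums.

(** * Triangle weights of a complex and spectra of its links *)

Section TriangleWeights.
Variables (R : realType) (V : finType) (X : {set {set V}}) (d : nat).
Hypothesis d2 : (2 <= d)%N.
Hypothesis Xd : d_complex d X.
Local Notation c x := #|cofaces X d x|.

Lemma sub_face (x y : {set V}) : y \in X -> x \subset y -> x \in X.
Proof. by case: Xd => _ h _; apply: h. Qed.

Lemma card_cofaces_eq0 (x : {set V}) : (c x == 0%N) = (x \notin X).
Proof.
apply/idP/idP; last first.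
  move=> xX; rewrite cards_eq0; apply/eqP/setP => y; rewrite !inE.
  by apply: contraNF xX => /andP [/andP [yX _] /(sub_face yX)].
apply: contraL => xX; rewrite -lt0n card_gt0; apply/set0Pn.
by case: Xd => _ _ /(_ x xX) [y yX /andP [yc xy]]; exists y; rewrite !inE yX yc xy.
Qed.

(** Double counting of pairs of a top face [y] containing [x] and a vertex [w] of [y] outside
    [x]. *)
Lemma sum_card_cofaces (x : {set V}) :
  (\sum_(w | w \notin x) c (w |: x) = (d.+1 - #|x|) * c x)%N.
Proof.
under eq_bigr => w _ do rewrite -sum1_card.
rewrite (exchange_big_dep (mem (cofaces X d x))) /=; last first.
  move=> w y _; rewrite !inE => /andP [-> /=]; rewrite subUset => /andP [_ ->] //.
rewrite mulnC -sum_nat_const; apply: eq_bigr => y; rewrite !inE => /andP [/andP [yX /eqP yc] xy].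
rewrite sum1dep_card -yc -cardsDS //; apply: eq_card => w.
by rewrite !inE yX yc eqxx subUset xy sub1set /= andbT.
Qed.

(** Up to a factor common to all triangles this is the canonical weight. The test [uniq] makes
    degenerate ordered triples weightless. *)
Definition triangle_weight u v w : R :=
  (if uniq [:: u; v; w] then c [set u; v; w] else 0)%:R.
Local Notation t := triangle_weight.

Lemma triangle_weight_ge0 u v w : 0 <= t u v w.
Proof. exact: ler0n. Qed.

Lemma triangle_weightC12 u v w : t u v w = t v u w.
Proof.
rewrite /t [[set u; v]]setUC /= !inE !negb_or [v == u]eq_sym.
by congr (if _ then _ else _)%:R; case: (u == v); case: (u == w); case: (v == w).
Qed.

Lemma triangle_weightC23 u v w : t u v w = t u w v.
Proof.
rewrite /t setUAC /= !inE !negb_or [w == v]eq_sym.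
by congr (if _ then _ else _)%:R; case: (u == v); case: (u == w); case: (v == w).
Qed.

Lemma triangle_weight_neq0 u v w :
  (t u v w != 0) = [&& u != v, u != w, v != w & [set u; v; w] \in X].
Proof.
rewrite /t pnatr_eq0 /= !inE negb_or andbT -!andbA.
case: (u == v); case: (u == w); case: (v == w) => //=.
by rewrite card_cofaces_eq0 negbK.
Qed.

Lemma edge_mass_triangle u v :
  edge_mass t u v = if u != v then (d.-1 * c [set u; v])%:R else 0.
Proof.
have [->|uv] /= := eqVneq u v; first by apply: big1 => w _; rewrite /t /= inE eqxx.
rewrite /edge_mass.
transitivity ((\sum_(w | w \notin [set u; v]) c (w |: [set u; v]))%:R : R).
  rewrite natr_sum [RHS]big_mkcond; apply: eq_bigr => w _.
  rewrite /t /= !inE negb_or uv andbT /= [w |: _]setUC [w == u]eq_sym [w == v]eq_sym.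
  by case: (u == w); case: (v == w).
by rewrite sum_card_cofaces cards2 uv subSS subn1.
Qed.

Lemma vertex_mass_triangle u :
  vertex_mass t u = (d * d.-1 * c [set u])%:R.
Proof.
transitivity ((d.-1 * \sum_(v | v \notin [set u]) c (v |: [set u]))%:R : R).
  rewrite natrM natr_sum mulr_sumr [RHS]big_mkcond; apply: eq_bigr => v _ /=.
  by rewrite edge_mass_triangle inE eq_sym setUC; case: eqP => //= _; rewrite natrM.
by rewrite sum_card_cofaces cards1 subSS subn0 mulnA [(d.-1 * d)%N]mulnC.
Qed.

Lemma edge_mass_gt0 u v : (0 < edge_mass t u v) = (u != v) && ([set u; v] \in X).
Proof.
rewrite edge_mass_triangle; case: (u != v) => /=; last by rewrite ltxx.
rewrite ltr0n muln_gt0 (_ : 0 < d.-1)%N; last by case: d d2 => [|[]].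
by rewrite lt0n card_cofaces_eq0 negbK.
Qed.

Lemma vertex_mass_gt0 u : (0 < vertex_mass t u) = ([set u] \in X).
Proof.
rewrite vertex_mass_triangle ltr0n !muln_gt0 [X in _ && X]lt0n card_cofaces_eq0 negbK.
by case: d d2 => [|[]].
Qed.

Lemma triangle_connected : connected_complex X ->
  forall u v, 0 < vertex_mass t u -> 0 < vertex_mass t v ->
  connect (fun x y => 0 < edge_mass t x y) u v.
Proof.
move=> Xc u v; rewrite !vertex_mass_gt0 => uX vX.
by rewrite (eq_connect edge_mass_gt0); exact: Xc.
Qed.

Section Link.
Variable a : V.
Hypothesis aX : [set a] \in X.
Local Notation L := (link X [set a]).

Lemma in_link (x : {set V}) : (x \in L) = (a \notin x) && (a |: x \in X).
Proof.
apply/imsetP/andP => [[y]|[ax axX]].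
  rewrite inE sub1set => /andP [yX ay] ->; rewrite !inE eqxx setD1K //.
exists (a |: x); rewrite ?inE ?axX ?sub1set ?setU11 //.
by rewrite setU1K.
Qed.

Lemma link_faces k (x : {set V}) : (x \in faces L k) = (a \notin x) && (a |: x \in faces X k.+1).
Proof.
rewrite inE in_link inE -andbA; case: (boolP (a \in x)) => //= ax.
by rewrite cardsU1 ax.
Qed.

Lemma card_link_cofaces (x : {set V}) : a \notin x -> #|cofaces L d.-1 x| = c (a |: x).
Proof.
move=> ax; have dE : d.-1.+1 = d by case: d d2.
have inj : {in cofaces L d.-1 x &, injective (fun y => a |: y)}.
  move=> y z; rewrite !inE !in_link -!andbA => /andP [ay _] /andP [az _] E.
  by rewrite -(setU1K ay) E setU1K.
rewrite -(card_in_imset inj); apply: eq_card => y.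
apply/imsetP/idP => [[z]|].
  rewrite inE link_faces dE => /andP [/andP [az zX] xz] ->.
  by rewrite inE zX setUS.
rewrite inE subUset sub1set => /and3P [yX ay xy]; exists (y :\ a); last by rewrite setD1K.
by rewrite inE link_faces dE setD1K // yX subsetD1 xy ax !inE eqxx.
Qed.

Lemma two_bin2 : (2 * 'C(d, 2) = d * d.-1)%N.
Proof. by rewrite -mul_bin_diag bin1. Qed.

(** Adding [a] matches top faces of the link with top faces through [a], so canonical weights in the
    link are proportional to [edge_mass t a] and [t a]. An eigenfunction for these masses is
    therefore one of the adjacency operator. *)
Lemma link_rayleigh_bound (la : R) : 0 <= la ->
  spectral_expander d.-1 L (-1) la -> rayleigh_bound (edge_mass t a) (t a) la.
Proof.
move=> la0 exp; apply: weighted_rayleigh => //.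
- exact: triangle_weightC23.
have dE : d.-1.+1 = d by case: d d2.
move=> b g [u0 eu0 gu0] gsum eig.
(* A vertex of the link is a singleton, so the sum reads [g] at its only element. *)
pose f : {ffun face L 0 -> R} := [ffun x : face L 0 => \sum_(u in (val x : {set V})) g u].
have L0 u : ([set u] \in faces L 0) = (0 < edge_mass t a u).
  rewrite link_faces edge_mass_gt0 in_set1; have [//|au] := eqVneq a u.
  by rewrite inE cards2 au andbT.
have fE (x : face L 0) u : val x = [set u] -> f x = g u.
  by move=> xu; rewrite ffunE xu big_set1.
pose K : R := #|faces L d.-1|%:R^-1.
have K0 : K != 0.
  rewrite invr_eq0 pnatr_eq0 -lt0n.
  have := card_link_cofaces (_ : a \notin set0); rewrite inE => /(_ isT).
  rewrite setU0 => E; have : (0 < c [set a])%N by rewrite lt0n card_cofaces_eq0 negbK.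
  by rewrite -E => /leq_trans; apply; apply: subset_leq_card; apply/subsetP => y; rewrite inE => /andP [].
have dR : d%:R != 0 :> R by rewrite pnatr_eq0 -lt0n; case: d d2.
have d1R : d.-1%:R != 0 :> R by rewrite pnatr_eq0 -lt0n; case: d d2 => [|[]].
have w1 u : [set u] \in faces L 0 ->
    weight R d.-1 L [set u] = K / (d%:R * d.-1%:R) * edge_mass t a u.
  move=> uL; have := uL; rewrite L0 edge_mass_gt0 => /andP [au _].
  rewrite /weight -/K dE cards1 bin1 card_link_cofaces ?inE //.
  by rewrite edge_mass_triangle au natrM; field; rewrite dR d1R.
(* The binomial in the weight of an edge yields a factor 2, which cancels the 2 in the adjacency
   operator; the transition weight becomes [t a u w / edge_mass t a u]. *)
have w2 u w : [set u; w] \in faces L 1 ->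
    2 * weight R d.-1 L [set u; w] = 4 * (K / (d%:R * d.-1%:R) * t a u w).
  move=> uL; have uw := set2_faces uL; have := uL; rewrite link_faces => /andP [auw _].
  rewrite /weight -/K dE cards2 uw card_link_cofaces //.
  move: (auw); rewrite !inE negb_or => /andP [au aw].
  rewrite /t /= !inE negb_or au aw uw /= setUA.
  have -> : 'C(d, 2)%:R = d%:R * d.-1%:R / 2 :> R.
    by rewrite -natrM -two_bin2 natrM mulrC mulKf // pnatr_eq0.
  by field; rewrite dR d1R.
have u0L : [set u0] \in faces L 0 by rewrite L0.
suff : -1 <= b <= la by case/andP.
apply: (exp b f).
- apply/eqP => /ffunP /(_ (Sub [set u0] u0L)); rewrite (fE _ u0) ?SubK // ffunE => /eqP.
  by rewrite (negPf gu0).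
- rewrite /zero_sum.
  transitivity (\sum_(u | [set u] \in faces L 0) weight R d.-1 L [set u] * \sum_(v in [set u]) g v).
    rewrite -(@big_vertices _ _ _ (fun x => weight R d.-1 L x * \sum_(v in x) g v)).
    by apply: eq_bigr => x _; rewrite ffunE.
  transitivity (K / (d%:R * d.-1%:R) * \sum_u edge_mass t a u * g u); last by rewrite gsum mulr0.
  rewrite mulr_sumr big_mkcond; apply: eq_bigr => u _.
  case: ifPn => [uL|]; first by rewrite w1 // big_set1 mulrA.
  rewrite L0 lt_def edge_mass_ge0 // andbT negbK => /eqP ->; by rewrite mul0r mulr0.
- apply/ffunP => x; rewrite !ffunE.
  have := valP x; set vx := val x => xL.
  have := xL; rewrite inE => /andP [_ /cards1P [u xu]].
  rewrite xu big_set1 in xL *.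
  have eu : 0 < edge_mass t a u by rewrite -L0.
  rewrite (@big_edges_at _ _ _ u (fun E => weight R d.-1 L E / (2 * weight R d.-1 L [set u]) *
     f (insubd x (E :\: [set u])))).
  transitivity (\sum_w t a u w * g w / edge_mass t a u); last first.
    by rewrite -mulr_suml eig; field; rewrite gt_eqF.
  rewrite big_mkcond; apply: eq_bigr => w _.
  case: ifPn => [uwL|]; last first.
    rewrite link_faces => h; suff -> : t a u w = 0 by rewrite !mul0r.
    apply/eqP; rewrite -[_ == _]negbK triangle_weight_neq0; apply: contra h.
    case/and4P => au aw uw tX; rewrite !inE negb_or au aw setUA tX /=.
    by rewrite -setUA cardsU1 cards2 !inE negb_or au aw uw.
  have uw := set2_faces uwL.
  have wL : [set w] \in faces L 0.
    move: uwL; rewrite !link_faces !inE negb_or => /and3P [/andP [_ aw] tX _].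
    rewrite aw cards2 aw eqxx andbT; apply: sub_face tX _.
    by apply/subsetP => y; rewrite !inE => /orP [] ->; rewrite ?orbT.
  have -> : [set u; w] :\: [set u] = [set w].
    by apply/setP => y; rewrite !inE; case: (eqVneq y u) => [->|] //=; rewrite (negPf uw).
  rewrite (fE _ w) ?insubdK // w1 //.
  have := w2 _ _ uwL; set W := weight _ _ _ _ => hW.
  have -> : W = 2 * (K / (d%:R * d.-1%:R) * t a u w) by lra.
  by field; rewrite K0 gt_eqF // dR d1R.
Qed.

End Link.
End TriangleWeights.

(** * Cocycles on triangles *)

Section CochainValues.
Variables (disp : Order.disp_t) (V : finOrderType disp).
Variables (F : fieldType) (X : {set {set V}}) (A : sheaf F X).
Hypothesis Xcl : forall x y : {set V}, y \in X -> x \subset y -> x \in X.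

(** Indexing by sets rather than by bundled faces lets values be rewritten along set equalities such
    as the symmetry of [[set u; v]]. *)
Definition cochain_at k (f : cochain A k) (x : {set V}) : stalk A x :=
  match @idP (x \in faces X k) with
  | ReflectT h => f (exist _ x h)
  | ReflectF _ => 0
  end.

Lemma cochain_at_val k (f : cochain A k) (x : face X k) : cochain_at f (val x) = f x.
Proof.
case: x => x h; rewrite /cochain_at /=; case: {-}_ / idP => [h'|//].
by rewrite (bool_irrelevance h' h).
Qed.

Lemma cochain_at_out k (f : cochain A k) x : x \notin faces X k -> cochain_at f x = 0.
Proof. by move=> xX; rewrite /cochain_at; case: {-}_ / idP => // h; rewrite h in xX. Qed.

Lemma faces_setD1 k (y : {set V}) z : y \in faces X k.+1 -> z \in y -> y :\ z \in faces X k.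
Proof.
rewrite !inE => /andP [yX yc] zy; rewrite (Xcl yX (subD1set _ _)) /=.
by move: yc; rewrite (cardsD1 z) zy.
Qed.

Lemma position_setD1 (y : {set V}) z : z \in y ->
  position (y :\ z) y = #|[set u in y | (u < z)%O]|.
Proof.
move=> zy; apply: eq_card => u; rewrite !inE; congr (_ && _).
apply/existsP/idP => [[v]|uz]; last by exists z; rewrite !inE eqxx zy.
by rewrite !inE negb_and negbK => /andP [/andP [/orP [/eqP ->//|/negPf ->]]].
Qed.

Lemma coboundaryE k (f : cochain A k) (y : face X k.+1) :
  coboundary A k f y = \sum_(z in (val y : {set V}))
    (-1) ^+ #|[set u in val y | (u < z)%O]| *:
      res A (val y :\ z) (val y) (cochain_at f (val y :\ z)).
Proof.
rewrite lfunE ffunE.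
transitivity (\sum_(x in faces X k | x \subset val y)
    (-1) ^+ position x (val y) *: res A x (val y) (cochain_at f x)).
  rewrite -(big_face X k (fun x => x \subset val y)
    (fun x => (-1) ^+ position x (val y) *: res A x (val y) (cochain_at f x))).
  by apply: eq_bigr => x _; rewrite cochain_at_val.
have yX := valP y; move: (val y) yX => {}y yX.
have inj : {in y &, injective (fun z => y :\ z)}.
  move=> z z' zy zy' /setP /(_ z); rewrite !inE eqxx zy andbT /=.
  by case: eqP.
rewrite (eq_bigl (mem ((fun z => y :\ z) @: y))) => [|x /=]; last first.
  apply/andP/imsetP => [[xX xy]|[z zy ->]]; last by rewrite faces_setD1 // subD1set.
  have : #|y :\: x| == 1%N.
    move: xX yX; rewrite cardsDS // !inE => /andP [_ /eqP ->] /andP [_ /eqP ->].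
    by rewrite subSS subSnn.
  move=> /cards1P [z yxz]; exists z; last by rewrite -yxz setDDr setDv set0U (setIidPr xy).
  by have : z \in y :\: x; [rewrite yxz set11 | rewrite inE => /andP []].
rewrite big_imset //=; apply: eq_bigr => z zy.
by rewrite position_setD1.
Qed.

(** The alternating extension of a 1-cochain to ordered pairs, which frees the cocycle relation from
    the fixed vertex order. *)
Definition oriented (f : cochain A 1) u v : stalk A [set u; v] :=
  if (u < v)%O then cochain_at f [set u; v] else - cochain_at f [set u; v].

Lemma oriented_eq0 f u v : (oriented f u v == 0) = (cochain_at f [set u; v] == 0).
Proof. by rewrite /oriented; case: ifP; rewrite // oppr_eq0. Qed.

Section Triangle.
Variables (f : cochain A 1) (y : {set V}).
Hypothesis yX : y \in X.
Local Notation phi u v := (res A [set u; v] y (oriented f u v)).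

Lemma restrict_orientedC u v : u != v -> phi u v = - phi v u.
Proof.
move=> uv; rewrite /oriented [[set v; u]]setUC.
by case: (ltgtP u v) uv => //= _ _; rewrite linearN ?opprK.
Qed.

Lemma sorted_triangle_set (p q r : V) : (p < q)%O -> (q < r)%O ->
  [set p; q; r] :\ p = [set q; r] /\ [set p; q; r] :\ q = [set p; r] /\
  [set p; q; r] :\ r = [set p; q] /\
  [set u in [set p; q; r] | (u < p)%O] = set0 /\
  [set u in [set p; q; r] | (u < q)%O] = [set p] /\
  [set u in [set p; q; r] | (u < r)%O] = [set p; q].
Proof.
move=> pq qr; have pr := lt_trans pq qr.
do !split; apply/setP => u; rewrite !inE;
  (case: (eqVneq u p) => [uE|_]; first by rewrite ?uE ?ltxx ?eqxx ?pq ?qr ?pr ?(lt_eqF pq) ?(gt_eqF pq) ?(lt_gtF pq)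
    ?(lt_eqF qr) ?(gt_eqF qr) ?(lt_gtF qr) ?(lt_eqF pr) ?(gt_eqF pr) ?(lt_gtF pr));
  (case: (eqVneq u q) => [uE|_]; first by rewrite ?uE ?ltxx ?eqxx ?pq ?qr ?pr ?(lt_eqF pq) ?(gt_eqF pq) ?(lt_gtF pq)
    ?(lt_eqF qr) ?(gt_eqF qr) ?(lt_gtF qr) ?(lt_eqF pr) ?(gt_eqF pr) ?(lt_gtF pr));
  (case: (eqVneq u r) => [uE|_]; first by rewrite ?uE ?ltxx ?eqxx ?pq ?qr ?pr ?(lt_eqF pq) ?(gt_eqF pq) ?(lt_gtF pq)
    ?(lt_eqF qr) ?(gt_eqF qr) ?(lt_gtF qr) ?(lt_eqF pr) ?(gt_eqF pr) ?(lt_gtF pr));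
  by rewrite ?andbF.
Qed.

Lemma big_triangle (T : zmodType) (p q r : V) (G : V -> T) : (p < q)%O -> (q < r)%O ->
  \sum_(z in [set p; q; r]) G z = G p + G q + G r.
Proof.
move=> pq qr; have pr := lt_trans pq qr.
rewrite setUC big_setU1 ?inE ?negb_or ?(gt_eqF pr) ?(gt_eqF qr) //=.
by rewrite big_setU1 ?inE ?(lt_eqF pq) // big_set1 addrC.
Qed.

Lemma sorted_triangle_cocycle p q r : f \in cocycles A 1 ->
  (p < q)%O -> (q < r)%O -> y = [set p; q; r] ->
  phi p q + phi q r + phi r p = 0.
Proof.
move=> fZ pq qr yE; have pr := lt_trans pq qr.
have yX2 : y \in faces X 2.
  rewrite inE yX yE setUC cardsU1 cards2 !inE negb_or.
  by rewrite (gt_eqF pr) (gt_eqF qr) (lt_eqF pq).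
rewrite (restrict_orientedC (u := r)) ?(gt_eqF pr) // /oriented pq qr pr.
have := coboundaryE f (Sub y yX2).
have /eqP -> : coboundary A 1 f == 0 by rewrite -memv_ker.
rewrite dprodv0E /= yE => /esym; rewrite (big_triangle _ pq qr).
have [-> [-> [-> [-> [-> ->]]]]] := sorted_triangle_set pq qr.
rewrite cards0 cards1 cards2 (lt_eqF pq) expr0 expr1 sqrrN expr1n !scale1r scaleN1r => h.
by rewrite -[RHS]h [RHS]addrC addrA.
Qed.

(** The relation is invariant under rotating the triangle and only changes sign under reversal, so
    every ordering reduces to the sorted one. *)
Lemma triangle_cocycle u v w : f \in cocycles A 1 ->
  u != v -> u != w -> v != w -> y = [set u; v; w] ->
  phi u v + phi v w + phi w u = 0.
Proof.
move=> fZ uv uw vw yE; have tri := sorted_triangle_cocycle fZ.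
have C := restrict_orientedC.
have E1 : y = [set v; u; w] by rewrite yE [[set u; v]]setUC.
have E2 : y = [set u; w; v] by rewrite yE setUAC.
have E3 : y = [set v; w; u] by rewrite yE -setUA setUC.
have E4 : y = [set w; u; v] by rewrite yE setUC setUA.
have E5 : y = [set w; v; u] by rewrite yE -setUA setUC [[set v; w]]setUC.
have Ca := C _ _ uv; have Cb := C _ _ vw; have Cc : phi w u = - phi u w by rewrite C // eq_sym.
have rot (a b c : stalk A y) : b + c + a = 0 -> a + b + c = 0 by rewrite addrC addrA.
have rev (a b c : stalk A y) : - c - b - a = 0 -> a + b + c = 0.
  by move=> h; apply/eqP; rewrite -oppr_eq0 !opprD addrC addrA addrAC h.
case: (ltgtP u v) uv => // luv _; case: (ltgtP v w) vw => // lvw _;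
  case: (ltgtP u w) uw => // luw _.
- exact: tri.
- by have := lt_trans (lt_trans luv lvw) luw; rewrite ltxx.
- by apply: rev; rewrite Ca Cb Cc !opprK; apply: tri.
- by apply/rot/rot; apply: tri.
- by apply: rev; apply/rot/rot; rewrite Ca Cb Cc !opprK; apply: tri.
- by apply: rot; apply: tri.
- by have := lt_trans (lt_trans luw lvw) luv; rewrite ltxx.
- by apply: rev; apply: rot; rewrite Ca Cb Cc !opprK; apply: tri.
Qed.

End Triangle.
End CochainValues.

Lemma faces_nonempty (V : finType) (X : {set {set V}}) k x :
  x \in faces X k -> nonempty_face X x.
Proof.
rewrite inE /nonempty_face => /andP [-> /eqP xk]; rewrite -card_gt0 xk //.
Qed.

(** * Cochains of a subsheaf inside those of the ambient sheaf *)

Section SubsheafCochains.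
Variables (disp : Order.disp_t) (V : finOrderType disp).
Variables (F : fieldType) (X : {set {set V}}) (A : sheaf F X) (B : subsheaf A).
Local Notation G := (sheaf_of_subsheaf B).

Definition incl_cochain_fun k (f : cochain G k) : cochain A k := [ffun x => vsval (f x)].

Fact incl_cochain_linear k : linear (@incl_cochain_fun k).
Proof.
move=> a f g; apply/dprodvP => x; rewrite dprodvDE dprodvZE.
by rewrite [LHS]ffunE [incl_cochain_fun f x]ffunE [incl_cochain_fun g x]ffunE dprodvDE dprodvZE linearP.
Qed.

HB.instance Definition _ k := GRing.isLinear.Build F (cochain G k) (cochain A k)
  _ (@incl_cochain_fun k) (@incl_cochain_linear k).

Definition incl_cochain k : 'Hom(cochain G k, cochain A k) := linfun (@incl_cochain_fun k).

Lemma incl_cochainE k f x : incl_cochain k f x = vsval (f x).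
Proof. by rewrite lfunE /= ffunE. Qed.

Lemma incl_cochain_inj k : lker (incl_cochain k) == 0%VS.
Proof.
apply/lker0P => f g /dprodvP fg; apply/dprodvP => x.
by apply: subvs_inj; have := fg x; rewrite !incl_cochainE.
Qed.

Lemma coboundary_incl k f :
  coboundary A k (incl_cochain k f) = incl_cochain k.+1 (coboundary G k f).
Proof.
apply/dprodvP => y; rewrite incl_cochainE !lfunE !ffunE /= linear_sum /=.
apply: eq_bigr => x xy; congr (_ *: _); rewrite sub_resE ?ffunE //.
- exact: faces_nonempty (valP x).
- exact: faces_nonempty (valP y).
have := valP y; have := valP x; rewrite !inE => /andP [_ /eqP xk] /andP [_ /eqP yk].
by rewrite properEcard xy (xk : #|sval x| = _) (yk : #|sval y| = _) /=.
Qed.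

Lemma incl_cochain_cocycle k f : (incl_cochain k f \in cocycles A k) = (f \in cocycles G k).
Proof.
rewrite !memv_ker coboundary_incl; apply/eqP/eqP => [|->]; last by rewrite linear0.
by move/eqP; rewrite -memv_ker (eqP (incl_cochain_inj _)) memv0 => /eqP.
Qed.

End SubsheafCochains.

(** * Labelling the link of a vertex by a cocycle *)

Section LocallyConstant.
Variables (disp : Order.disp_t) (V : finOrderType disp).
Variables (F : fieldType) (X : {set {set V}}) (A : sheaf F X) (m : nat).
Hypothesis Xcl : forall x y : {set V}, y \in X -> x \subset y -> x \in X.
Hypothesis Aloc : locally_constant A m.

Lemma res_inj (x y : {set V}) : nonempty_face X x -> y \in X -> x \proper y ->
  injective (res A x y).
Proof.
move=> Xx yX xy; case: Aloc => _ /(_ x y Xx) h; apply: bij_inj; apply: h => //.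
rewrite /nonempty_face yX; apply: contraTneq xy => ->.
by rewrite properE sub0set andbF.
Qed.

Lemma res_eq0 (x y : {set V}) a : nonempty_face X x -> y \in X -> x \proper y ->
  (res A x y a == 0) = (a == 0).
Proof. by move=> Xx yX xy; rewrite -(inj_eq (res_inj Xx yX xy)) linear0. Qed.

Section LocalLabels.
Variable f : cochain A 1.
Hypothesis fZ : f \in cocycles A 1.

(** Edges at [v] are oriented away from [v] and pulled back to the one stalk at [v], where they can
    be compared. On edges of [X] the inverse is genuine by local constancy. *)
Definition local_label v u : stalk A [set v] :=
  ((res A [set v] [set v; u])^-1)%VF (oriented f v u).

Lemma set2_face1 u v : u != v -> [set u; v] \in X -> [set u; v] \in faces X 1.
Proof. by move=> uv uvX; rewrite inE uvX cards2 uv. Qed.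

Lemma vertex_nonempty u v : [set u; v] \in X -> nonempty_face X [set u].
Proof.
move=> uvX; apply/andP; split; last by apply/set0Pn; exists u; rewrite inE.
by apply: Xcl uvX _; rewrite subsetUl.
Qed.

Lemma vertex_proper (u v : V) : u != v -> [set u] \proper [set u; v].
Proof. by move=> uv; rewrite properEcard subsetUl cards1 cards2 uv. Qed.

Lemma local_labelK v u : v != u -> [set v; u] \in X ->
  res A [set v] [set v; u] (local_label v u) = oriented f v u.
Proof.
move=> vu vuX; rewrite /local_label limg_lfunVK //.
case: Aloc => _ /(_ [set v] [set v; u] (vertex_nonempty vuX)).
case=> [||g gK Kg]; [by apply: faces_nonempty (set2_face1 vu vuX) | exact: vertex_proper |].
by rewrite -(Kg (oriented f v u)) memv_img ?memvf.
Qed.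

Lemma local_label_eq0 v u : v != u -> [set v; u] \in X ->
  (local_label v u == 0) = (cochain_at f [set v; u] == 0).
Proof.
move=> vu vuX; rewrite -oriented_eq0 -local_labelK // res_eq0 //.
  exact: vertex_nonempty vuX.
exact: vertex_proper.
Qed.

Section Triangle.
Variables v u w : V.
Hypothesis vu : v != u.
Hypothesis vw : v != w.
Hypothesis uw : u != w.
Hypothesis yX : [set v; u; w] \in X.
Local Notation y := [set v; u; w].

Let edge_sub (a b : V) : a != b -> [set a; b] \subset y ->
  [/\ [set a; b] \in X, nonempty_face X [set a; b] & [set a; b] \proper y].
Proof.
move=> ab aby; have abX := Xcl yX aby; split=> //.
  exact: faces_nonempty (set2_face1 ab abX).
rewrite properEcard aby cards2 ab setUC cardsU1 cards2 !inE negb_or.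
by rewrite ![w == _]eq_sym vw uw vu.
Qed.

Let vu_sub : [set v; u] \subset y. Proof. exact: subsetUl. Qed.
Let vw_sub : [set v; w] \subset y.
Proof. by rewrite setUAC subsetUl. Qed.
Let uw_sub : [set u; w] \subset y.
Proof. by rewrite -setUA subsetUr. Qed.

Let res_label a : v != a -> [set v; a] \subset y ->
  res A [set v; a] y (oriented f v a) = res A [set v] y (local_label v a).
Proof.
move=> va vay; have [vaX Nva Pva] := edge_sub va vay.
have Ny : nonempty_face X y.
  by rewrite /nonempty_face yX; apply/set0Pn; exists v; rewrite !inE eqxx.
have := res_comp A (vertex_nonempty vaX) Nva Ny (vertex_proper va) Pva.
by move=> <-; rewrite lfunE /= local_labelK.
Qed.

Lemma label_triangle :
  res A [set u; w] y (oriented f u w) =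
  res A [set v] y (local_label v w) - res A [set v] y (local_label v u).
Proof.
have := triangle_cocycle Xcl yX fZ vu vw uw erefl.
rewrite (restrict_orientedC _ y (u := w)) 1?eq_sym // !res_label // => /eqP.
by rewrite subr_eq0 addrC => /eqP <-; rewrite addrK.
Qed.

(** By the cocycle relation the value on the edge opposite [v] is, inside the triangle, the
    difference of the two labels; restrictions to the triangle are injective. *)
Lemma local_label_eq : (local_label v u == local_label v w) =
  (cochain_at f [set u; w] == 0).
Proof.
have [uwX Nuw Puw] := edge_sub uw uw_sub.
have [vuX Nvu Pvu] := edge_sub vu vu_sub.
rewrite -oriented_eq0 -(res_eq0 (oriented f u w) Nuw yX Puw) label_triangle subr_eq0.
rewrite (inj_eq (res_inj (vertex_nonempty vuX) yX _)) 1?eq_sym //.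
exact: proper_trans (vertex_proper vu) Pvu.
Qed.

Lemma cocycle_support_triangle : cochain_at f [set v; u] != 0 ->
  (cochain_at f [set v; w] != 0) || (cochain_at f [set u; w] != 0).
Proof.
have [vwX _ _] := edge_sub vw vw_sub; have [vuX _ _] := edge_sub vu vu_sub.
rewrite -local_label_eq -!local_label_eq0 // => h.
by have [->|//] := eqVneq (local_label v w) 0; rewrite h.
Qed.

End Triangle.
End LocalLabels.
End LocallyConstant.

(** * Distance *)

Lemma sum_ordered_edges (R : realType) (V : finType) (X : {set {set V}}) (G : {set V} -> R) :
  \sum_v \sum_(u | [set v; u] \in faces X 1) G [set v; u] = 2 * \sum_(x in faces X 1) G x.
Proof.
transitivity (\sum_v \sum_(x in faces X 1 | v \in x) G x).
  apply: eq_bigr => v _; rewrite -big_edges_at (big_face X 1 (fun x => [set v] \subset x) G).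
  by apply: eq_bigl => x; rewrite sub1set.
rewrite (exchange_big_dep (mem (faces X 1))) => [|v x _ /andP [] //].
rewrite mulr_sumr; apply: eq_bigr => x xX.
rewrite (eq_bigl (mem x)) => [|v]; last by rewrite (xX : x \in _).
by move: xX; rewrite /= inE => /andP [_ /eqP xc]; rewrite sumr_const xc mulr_natl.
Qed.

Lemma card_edges_at (V : finType) (X : {set {set V}}) v :
  #|[set u | [set v; u] \in faces X 1]| = #|cofaces X 1 [set v]|.
Proof.
rewrite -(card_in_imset (f := fun u => [set v; u])).
  apply: eq_card => x; apply/imsetP/coface1P => [[u]|[u uX ->]].
    by rewrite in_set => uX ->; exists u.
  by exists u => //; rewrite in_set.
move=> u w; rewrite in_set => /set2_faces vu; rewrite in_set => /set2_faces vw.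
by apply: set2_injr; rewrite inE.
Qed.

Section CocycleDistance.
Variables (R : realType) (disp : Order.disp_t) (V : finOrderType disp).
Variables (X : {set {set V}}) (d Q r m : nat) (la kappa : R).
Hypothesis d2 : (2 <= d)%N.
Hypothesis Xd : d_complex d X.
Hypothesis Xconn : connected_complex X.
Hypothesis XQ : forall v, v \in faces X 0 -> #|cofaces X 1 v| = Q.
Hypothesis kappa_gt0 : 0 < kappa.
Hypothesis balanced : forall e e', e \in faces X 1 -> e' \in faces X 1 ->
  e :&: e' != set0 -> weight R d X e' <= kappa * weight R d X e.
Hypothesis Q0 : (0 < Q)%N.
Hypothesis r0 : (0 < r)%N.
Hypothesis m0 : (0 < m)%N.
Variables (F : fieldType) (A : sheaf F X) (U : forall e, {vspace stalk A e}).
Hypothesis Aloc : locally_constant A m.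
Hypothesis general_position : forall v (S : {set {set V}}),
  v \in faces X 0 -> S \subset cofaces X 1 v -> (m <= #|S| * r)%N ->
  (\bigcap_(e in S) (res A v e @^-1: U e))%VS = 0%VS.
Variable f : cochain A 1.
Hypothesis fZ : f \in cocycles A 1.
Hypothesis fU : forall x : face X 1, f x \in U (val x).

Local Notation t := (triangle_weight R X d).
Local Notation e := (edge_mass t).
Local Notation n := (vertex_mass t).
Local Notation c x := #|cofaces X d x|.
Let p := (kappa / Q%:R) / (r%:R / m%:R) : R.
Let Xcl := sub_face Xd.
Let t0 := @triangle_weight_ge0 R V X d.
Let tC12 := @triangle_weightC12 R V X d.
Let tC23 := @triangle_weightC23 R V X d.

Let cochain_atU x : cochain_at f x \in U x.
Proof.
have [xX|xX] := boolP (x \in faces X 1); last by rewrite cochain_at_out // mem0v.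
by have := fU (Sub x xX); rewrite -cochain_at_val.
Qed.

Let edge_pos v u : (0 < e v u) = ([set v; u] \in faces X 1).
Proof.
rewrite edge_mass_gt0 // inE cards2; case: (v != u) => /=; last by rewrite andbF.
by rewrite andbT.
Qed.

(** By balance, the mass of [v u] is at most [kappa] times that of each of the [Q] edges at [v];
    these masses sum to [n v]. *)
Lemma edge_mass_balanced v u : Q%:R * e v u <= kappa * n v.
Proof.
have := edge_mass_ge0 t0 v u; rewrite le_eqVlt => /predU1P [<-|vu].
  by rewrite mulr0 mulr_ge0 ?(ltW kappa_gt0) ?vertex_mass_ge0.
have := vu; rewrite edge_pos => vuX.
have vX : [set v] \in faces X 0.
  by rewrite inE cards1 andbT (Xcl (_ : [set v; u] \in X)) ?subsetUl //; move: vuX; rewrite inE => /andP [].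
rewrite -(XQ vX) -card_edges_at -sumr_const mulr_suml [kappa * _]mulr_sumr.
rewrite [leLHS]big_mkcond /=; apply: ler_sum => w _; rewrite in_set; case: ifPn => vwX; last first.
  by rewrite mulr_ge0 ?(ltW kappa_gt0) ?edge_mass_ge0.
rewrite mul1r !edge_mass_triangle // (set2_faces vuX) (set2_faces vwX) !natrM mulrCA.
rewrite ler_wpM2l //.
have := balanced vwX vuX; rewrite /weight !cards2 (set2_faces vuX) (set2_faces vwX).
have -> : [set v; w] :&: [set v; u] != set0 by apply/set0Pn; exists v; rewrite !inE eqxx.
move=> /(_ isT); rewrite mulrCA ler_pM2l // mulr_gt0 // invr_gt0 ltr0n.
  by rewrite bin_gt0; lia.
case: Xd => _ _ /(_ [set v; u]); rewrite inE in vuX; case/andP: vuX => [uX _] /(_ uX) [y yX /andP [yd _]].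
by rewrite card_gt0; apply/set0Pn; exists y; rewrite inE yX.
Qed.

(** A label shared by a set [P] of edges lies in every preimage of [U] along [P], so general
    position makes it zero once [#|P| * r >= m]. A nonzero label thus occurs on fewer than [m / r]
    edges, each of proportion at most [kappa / Q]. *)
Lemma label_class_mass v (a : stalk A [set v]) : a != 0 ->
  \sum_u e v u * (local_label f v u == a)%:R <= p * n v.
Proof.
move=> a0; pose P := [set u | ([set v; u] \in faces X 1) && (local_label f v u == a)].
have n0 := vertex_mass_ge0 t0 v.
have p0 : 0 <= p by rewrite /p !divr_ge0 // ltW.
have [P0|P0] := eqVneq P set0.
  rewrite big1 => [|u _]; first exact: mulr_ge0.
  have [ua|] := boolP (_ == a); last by rewrite mulr0.
  have : u \notin P by rewrite P0 inE.
  rewrite inE ua andbT -edge_pos lt_def edge_mass_ge0 // andbT negbK => /eqP ->.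
  by rewrite mul0r.
have /set0Pn [u0] := P0; rewrite inE => /andP [u0X _].
have vX : [set v] \in faces X 0.
  by rewrite inE cards1 andbT (Xcl (_ : [set v; u0] \in X)) ?subsetUl //; move: u0X; rewrite inE => /andP [].
have Pm : (#|P| * r < m)%N.
  rewrite ltnNge; apply: contra a0 => hm.
  have E : #|[set [set v; u] | u in P]| = #|P|.
    apply: card_in_imset => u w; rewrite in_set => /andP [/set2_faces vu _].
    by rewrite in_set => /andP [/set2_faces vw _]; apply: set2_injr; rewrite inE.
  have Psub : [set [set v; u] | u in P] \subset cofaces X 1 [set v].
    apply/subsetP => x /imsetP [u]; rewrite in_set => /andP [uX _] ->.
    by apply/coface1P; exists u.
  rewrite -memv0 -(general_position vX Psub) ?E // memvE; apply/subv_bigcapP => x.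
  move=> /imsetP [u]; rewrite in_set => /andP [uX /eqP ua] ->.
  rewrite -memvE -memv_preim -ua (local_labelK Xcl Aloc) ?(set2_faces uX) //.
    by rewrite /oriented; case: ifP => _; rewrite ?rpredN cochain_atU.
  by move: uX; rewrite inE => /andP [].
have QR : 0 < Q%:R :> R by rewrite ltr0n.
have rR : 0 < r%:R :> R by rewrite ltr0n.
have mR : 0 < m%:R :> R by rewrite ltr0n.
apply: (@le_trans _ _ (\sum_(u in P) kappa / Q%:R * n v)).
  rewrite [leRHS]big_mkcond; apply: ler_sum => u _; rewrite in_set -edge_pos.
  have [_|] := boolP (_ == a); last by rewrite andbF mulr0.
  rewrite andbT mulr1; case: ifPn => [_|].
    by rewrite mulrAC ler_pdivlMr // mulrC edge_mass_balanced.
  by rewrite lt_def edge_mass_ge0 // andbT negbK => /eqP ->.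
rewrite sumr_const -[_ *+ #|P|]mulr_natr.
have -> : p * n v = kappa / Q%:R * n v * (m%:R / r%:R) by rewrite /p; field; rewrite !gt_eqF.
rewrite ler_wpM2l //; first by rewrite mulr_ge0 // divr_ge0 // ltW.
by rewrite ler_pdivlMr // -natrM ler_nat ltnW.
Qed.

Hypothesis la01 : 0 <= la < 1.
Hypothesis p1 : p < 1.
Hypothesis link_expander : forall v, v \in faces X 0 ->
  spectral_expander d.-1 (link X v) (-1) la.

Let link_bound v : rayleigh_bound (e v) (t v) la.
Proof.
have /andP [la0 la1] := la01.
have [vX|vX] := boolP ([set v] \in X).
  apply: link_rayleigh_bound => //; apply: link_expander.
  by rewrite inE vX cards1.
have nv : n v = 0.
  apply/eqP; have := vertex_mass_ge0 t0 v; rewrite le_eqVlt eq_sym vertex_mass_gt0 //.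
  by rewrite (negPf vX) orbF.
move=> g _; rewrite !big1 ?mulr0 // => u _; first by rewrite vertex_mass0 // mul0r.
by rewrite big1 // => w _; rewrite edge_mass0 ?mul0r // vertex_mass0.
Qed.

Let S u v := cochain_at f [set u; v] != 0.

Let triangleP v u w : t v u w != 0 -> [/\ v != u, v != w, u != w & [set v; u; w] \in X].
Proof. by rewrite triangle_weight_neq0 // => /and4P []. Qed.

Lemma local_expansion v :
  (1 - la) * (1 - p) * \sum_u e v u * (S v u)%:R <= \sum_u \sum_w t v u w * (S u w)%:R.
Proof.
have /andP [la0 la1] := la01.
have := vertex_mass_ge0 t0 v; rewrite le_eqVlt => /predU1P [/esym nv|nv].
  rewrite [\sum_u e v u * _]big1 => [|u _]; last by rewrite vertex_mass0 // mul0r.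
  by rewrite mulr0 sumr_ge0 // => u _; rewrite sumr_ge0 // => w _; rewrite mulr_ge0.
(* [pick] makes the label an element of a finite type, as [label_expansion] requires. *)
pose lab u := [pick u' | local_label f v u' == local_label f v u].
(* [Z] sets aside the zero label, whose class [label_class_mass] does not bound. The value [None] is
   never attained, so its class is empty. *)
pose Z (l : option V) := if l is Some u' then local_label f v u' == 0 else false.
have labP u : exists2 u', lab u = Some u' & local_label f v u' = local_label f v u.
  rewrite /lab; case: pickP => [u' /eqP ?|/(_ u)]; last by rewrite eqxx.
  by exists u'.
have lab_eq u w : (lab u == lab w) = (local_label f v u == local_label f v w).
  apply/eqP/eqP => [E|E]; last by rewrite /lab E.
  have [u' Eu <-] := labP u; have [w' Ew <-] := labP w.
  by move: E; rewrite Eu Ew => -[->].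
have ZE u : Z (lab u) = (local_label f v u == 0).
  by have [u' Eu Lu] := labP u; rewrite Eu /= Lu.
have wpos i := edge_mass_ge0 t0 v i.
have := @label_expansion _ _ _ _ _ (tC23 v) (fun=> erefl) (@link_bound v) nv _ lab Z p
  wpos (t0 v) (ltW la1).
have hp (l : option V) : ~~ Z l -> \sum_i e v i * (lab i == l)%:R <= p * \sum_i e v i.
  move=> Zl; have [/existsP [u /eqP lu]|/existsPn nl] := boolP [exists u, lab u == l].
    rewrite -lu in Zl *; rewrite ZE in Zl.
    apply: le_trans (label_class_mass Zl).
    by apply: ler_sum => w _; rewrite lab_eq.
  rewrite big1 => [|u _]; last by rewrite (negPf (nl u)) mulr0.
  by apply: mulr_ge0; [rewrite /p !divr_ge0 // ltW | exact: sumr_ge0].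
move=> /(_ hp); congr (_ * _ <= _).
  apply: eq_bigr => u _; rewrite ZE -/(e v u).
  have [->|eu] := eqVneq (e v u) 0; first by rewrite !mul0r.
  have : 0 < e v u by rewrite lt_def eu wpos.
  rewrite edge_mass_gt0 // => /andP [vu vuX].
  by rewrite (local_label_eq0 Xcl Aloc).
apply: eq_bigr => u _; apply: eq_bigr => w _.
have [->|/triangleP [vu vw uw yX]] := eqVneq (t v u w) 0; first by rewrite !mul0r.
by rewrite lab_eq (local_label_eq Xcl Aloc fZ).
Qed.

(** Passage from mass to number of edges: every edge lies in at least one and at most [maxdeg d X]
    top faces, which is where the maximal degree enters. *)
Lemma cocycle_support_bound (eta : R) :
  eta = (1 - la) * (1 - p) / 4 - la -> 0 < eta -> la / (1 - la) <= eta ^+ 2 / 6 ->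
  f != 0 ->
  5 / 24 * ((1 - la) * (1 - p)) * eta ^+ 2 * #|faces X 1|%:R <=
  (maxdeg d X)%:R * #|[set x : face X 1 | f x != 0]|%:R.
Proof.
move=> etaE eta0 laeta f0; have /andP [la0 la1] := la01.
have p0 : 0 <= p by rewrite /p !divr_ge0 // ltW.
set eps := (1 - la) * (1 - p) in etaE *.
have eps01 : 0 < eps <= 1.
  by rewrite mulr_gt0 ?subr_gt0 //= mulr_ile1 ?subr_ge0 ?(ltW p1) ?(ltW la1) // gerBl.
have Ssym : symmetric S by move=> u v; rewrite /S [[set u; v]]setUC.
have Stri v u w : t v u w != 0 -> S v u -> S v w || S u w.
  by move=> /triangleP [vu vw uw yX]; exact: (cocycle_support_triangle Xcl Aloc fZ).
have := sparse_support_bound t0 tC12 tC23 la01 eps01 etaE eta0 laeta link_bound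
  (@triangle_connected R V X d d2 Xd Xconn) Ssym Stri local_expansion.
have eE v u : e v u = if [set v; u] \in faces X 1 then (d.-1 * c [set v; u])%:R else 0.
  case: ifPn => h; first by rewrite edge_mass_triangle // (set2_faces h).
  by apply/eqP; move: h; rewrite -edge_pos lt_def edge_mass_ge0 // andbT negbK.
have -> : \sum_v \sum_u e v u * (S v u)%:R =
    2 * \sum_(x in faces X 1) (d.-1 * c x)%:R * (cochain_at f x != 0)%:R.
  rewrite -sum_ordered_edges; apply: eq_bigr => v _; rewrite [RHS]big_mkcond.
  by apply: eq_bigr => u _; rewrite eE; case: ifP => //; rewrite mul0r.
have -> : \sum_v n v = 2 * \sum_(x in faces X 1) (d.-1 * c x)%:R.
  rewrite -sum_ordered_edges; apply: eq_bigr => v _; rewrite [RHS]big_mkcond.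
  by apply: eq_bigr => u _; rewrite eE.
have d1 : (0 < d.-1)%N by case: d d2 => [|[]].
have cpos x : x \in faces X 1 -> (0 < c x)%N.
  by rewrite inE => /andP [xX _]; rewrite lt0n card_cofaces_eq0 // negbK.
have cmax x : x \in faces X 1 -> (c x <= maxdeg d X)%N.
  move=> xX1; have := xX1; rewrite inE => /andP [xX /eqP xc].
  have /card_gt0P [v vx] : (0 < #|x|)%N by rewrite xc.
  have vX : [set v] \in faces X 0 by rewrite inE cards1 (Xcl xX) ?sub1set.
  apply: leq_trans (leq_bigmax_cond _ vX); apply: subset_leq_card; apply/subsetP => y.
  rewrite !inE => /andP [-> xy] /=; by apply: subset_trans xy; rewrite sub1set.
have supp : \sum_(x in faces X 1) (cochain_at f x != 0)%:R =
    #|[set x : face X 1 | f x != 0]|%:R :> R.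
  rewrite -sum1dep_card natr_sum [RHS]big_mkcond /=.
  transitivity (\sum_(x : face X 1) (cochain_at f (val x) != 0)%:R : R).
    rewrite (big_face X 1 predT (fun x => (cochain_at f x != 0)%:R : R)).
    by apply: eq_bigl => x; rewrite andbT.
  by apply: eq_bigr => x _; rewrite cochain_at_val; case: (f x != 0).
(* Every edge has positive mass, so a support of mass zero is empty, contradicting [f != 0]. *)
case=> [W0|].
  suff : f == 0 by rewrite (negPf f0).
  apply/eqP/dprodvP => x; rewrite dprodv0E; apply/eqP; rewrite -[_ == _]negbK; apply/negP => fx.
  move/eqP: W0; rewrite mulf_eq0 pnatr_eq0 /= psumr_eq0 => [|y _]; last by rewrite mulr_ge0.
  move=> /allP /(_ (val x)); rewrite mem_index_enum => /(_ isT); rewrite (valP x) /=.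
  rewrite cochain_at_val fx mulr1 pnatr_eq0 muln_eq0 => /orP [] /eqP E.
    by rewrite E in d1.
  by have := cpos _ (valP x); rewrite E.
move=> h; have d1R : 0 < 2 * d.-1%:R :> R by rewrite mulr_gt0 // ltr0n.
rewrite -(ler_pM2l d1R).
have K0 : 0 <= 5 / 24 * eps * eta ^+ 2.
  case/andP: eps01 => eps0 _.
  by apply: mulr_ge0; [apply: mulr_ge0; [lra | exact: ltW] | exact: sqr_ge0].
apply: (@le_trans _ _ (5 / 24 * eps * eta ^+ 2 * (2 * \sum_(x in faces X 1) (d.-1 * c x)%:R))).
  rewrite mulrCA ler_wpM2l // -mulrA ler_pM2l // mulr_natr -sumr_const.
  by apply: ler_sum => x xX; rewrite ler_nat leq_pmulr ?cpos.
apply: le_trans h _; rewrite -mulrA ler_pM2l // mulrA -supp !mulr_sumr.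
apply: ler_sum => x xX; rewrite ler_wpM2r // -natrM ler_nat leq_mul2l; by rewrite cmax ?orbT.
Qed.

End CocycleDistance.

(** * Rate *)

Section SortedSets.
Variables (disp : Order.disp_t) (V : finOrderType disp).

Lemma sorted_pair (y : {set V}) : #|y| = 2 ->
  exists p q, (p < q)%O /\ y = [set p; q].
Proof.
move=> /eqP /cards2P [a [b [ab ->]]].
case: (ltgtP a b) ab => // h _; first by exists a, b.
by exists b, a; rewrite setUC.
Qed.

Lemma sorted_triple (y : {set V}) : #|y| = 3 ->
  exists p q r, [/\ (p < q)%O, (q < r)%O & y = [set p; q; r]].
Proof.
move=> y3; have /card_gt0P [a ay] : (0 < #|y|)%N by rewrite y3.
have y2 : #|y :\ a| = 2 by move: y3; rewrite (cardsD1 a) ay => -[].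
have [p [q [pq E]]] := sorted_pair y2.
have yE : y = [set a; p; q] by rewrite -setUA -E setD1K.
have : a \notin [set p; q] by rewrite -E !inE eqxx.
rewrite !inE negb_or => /andP [].
case: (ltgtP a p) => // ap _ => [|aq].
  by exists a, p, q.
case: (ltgtP a q) aq => // aq _.
  by exists p, a, q; rewrite yE [[set a; p]]setUC.
by exists p, q, a; rewrite yE -setUA setUC.
Qed.

End SortedSets.

Section CoboundaryComplex.
Variables (disp : Order.disp_t) (V : finOrderType disp).
Variables (F : fieldType) (X : {set {set V}}) (A : sheaf F X).
Hypothesis Xcl : forall x y : {set V}, y \in X -> x \subset y -> x \in X.

Lemma coboundary0E (f : cochain A 0) (p q : V) : (p < q)%O -> [set p; q] \in X ->
  cochain_at (coboundary A 0 f) [set p; q] =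
  res A [set q] [set p; q] (cochain_at f [set q]) -
  res A [set p] [set p; q] (cochain_at f [set p]).
Proof.
move=> pq pqX; have yX : [set p; q] \in faces X 1 by rewrite inE pqX cards2 (lt_eqF pq).
have /= -> := cochain_at_val (coboundary A 0 f) (Sub [set p; q] yX : face X 1); rewrite coboundaryE //=.
rewrite big_setU1 ?inE ?(lt_eqF pq) //= big_set1.
have -> : [set p; q] :\ p = [set q] by rewrite setU1K // inE (lt_eqF pq).
have -> : [set p; q] :\ q = [set p] by rewrite setUC setU1K // inE (gt_eqF pq).
have -> : [set u in [set p; q] | (u < p)%O] = set0.
  by apply/setP => u; rewrite !inE; case: (eqVneq u p) => [->|_]; rewrite ?ltxx //=;
     case: (eqVneq u q) => [->|_]; rewrite //= (lt_gtF pq).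
have -> : [set u in [set p; q] | (u < q)%O] = [set p].
  apply/setP => u; rewrite !inE; case: (eqVneq u p) => [->|_]; first by rewrite pq.
  by case: (eqVneq u q) => [->|_] //=; rewrite ltxx.
by rewrite cards0 cards1 expr0 expr1 scale1r scaleN1r.
Qed.

(** Restricted to a triangle, each edge value becomes a difference of two vertex values, and the
    signed sum telescopes. *)
Lemma coboundary_cocycle (f : cochain A 0) : coboundary A 0 f \in cocycles A 1.
Proof.
rewrite memv_ker; apply/eqP/dprodvP => y; rewrite dprodv0E coboundaryE //.
have := valP y; move: (val y) => {}y; rewrite inE => /andP [yX /eqP yc].
have [p [q [r [pq qr yE]]]] := sorted_triple yc; have pr := lt_trans pq qr.
rewrite yE (big_triangle _ pq qr).
have [-> [-> [-> [-> [-> ->]]]]] := sorted_triangle_set pq qr.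
rewrite cards0 cards1 cards2 (lt_eqF pq) expr0 expr1 sqrrN expr1n !scale1r scaleN1r -yE.
have R a b : (a < b)%O -> [set a; b] \subset y ->
    res A [set a; b] y (cochain_at (coboundary A 0 f) [set a; b]) =
    res A [set b] y (cochain_at f [set b]) - res A [set a] y (cochain_at f [set a]).
  move=> ab aby; have abX := Xcl yX aby; rewrite coboundary0E // linearB /=.
  have Ny : nonempty_face X y.
    by rewrite /nonempty_face yX -card_gt0 yc.
  have Nab : nonempty_face X [set a; b].
    by rewrite /nonempty_face abX; apply/set0Pn; exists a; rewrite !inE eqxx.
  have Pab : [set a; b] \proper y by rewrite properEcard aby yc cards2 (lt_eqF ab).
  have Na : nonempty_face X [set a] by exact: (vertex_nonempty Xcl abX).
  have Nb : nonempty_face X [set b].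
    by apply: (vertex_nonempty Xcl (v := a)); rewrite setUC.
  rewrite -(res_comp A Na Nab Ny _ Pab) ?vertex_proper ?(lt_eqF ab) //.
  rewrite -(res_comp A Nb Nab Ny _ Pab) ?lfunE //.
  by rewrite setUC vertex_proper // (gt_eqF ab).
rewrite !R //.
- by rewrite opprB [X in X + _ = _]addrC !addrA !subrK subrr.
- by rewrite yE subsetUl.
- by rewrite yE setUAC subsetUl.
- by rewrite yE -setUA subsetUr.
Qed.

End CoboundaryComplex.

(** * Dimension counts for cocycles *)

Section CocycleRate.
Variables (disp : Order.disp_t) (V : finOrderType disp).
Variables (F : fieldType) (X : {set {set V}}) (A : sheaf F X) (m : nat).
Hypothesis Xcl : forall x y : {set V}, y \in X -> x \subset y -> x \in X.
Hypothesis Xconn : connected_complex X.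
Hypothesis Aloc : locally_constant A m.

Lemma dim_cochain (B : sheaf F X) k n :
  (forall x : face X k, \dim {: stalk B (val x)} = n) ->
  \dim {: cochain B k} = (#|faces X k| * n)%N.
Proof.
move=> Bn; rewrite dimvf /dim /= card_tagged sumnE big_map big_enum /=.
rewrite (eq_bigr (fun=> n)) => [|x _]; last by rewrite card_ord -(Bn x) dimvf.
rewrite sum_nat_const; congr (_ * _)%N; rewrite card_sig; exact: eq_card.
Qed.

Lemma coboundary0_edge (f : cochain A 0) (u v : V) : coboundary A 0 f = 0 ->
  u != v -> [set u; v] \in X ->
  res A [set u] [set u; v] (cochain_at f [set u]) =
  res A [set v] [set u; v] (cochain_at f [set v]).
Proof.
move=> df0.
have H (p q : V) : (p < q)%O -> [set p; q] \in X ->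
    res A [set q] [set p; q] (cochain_at f [set q]) =
    res A [set p] [set p; q] (cochain_at f [set p]).
  move=> pq pqX; apply/eqP; rewrite -subr_eq0 -coboundary0E // df0.
  by rewrite /cochain_at; case: {-}_ / idP => // h; rewrite dprodv0E.
case: (ltgtP u v) => // uv _ uvX; first by rewrite H.
by rewrite setUC H // setUC.
Qed.

(** Evaluation at [v0] is injective on the kernel: a section vanishing at one end of an edge
    vanishes at the other, because restrictions are injective, and connectedness carries this to all
    vertices. *)
Lemma dim_constant_sections v0 : [set v0] \in X ->
  (\dim (lker (coboundary A 0)) <= m)%N.
Proof.
move=> v0X; have v0X0 : [set v0] \in faces X 0 by rewrite inE v0X cards1.
pose x0 : face X 0 := Sub [set v0] v0X0.
pose evf (f : cochain A 0) : stalk A (val x0) := f x0.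
have evL : linear evf by move=> a f g; rewrite /evf dprodvDE dprodvZE.
pose evM := GRing.isLinear.Build F _ _ _ evf evL.
pose evl : {linear cochain A 0 -> stalk A (val x0)} := HB.pack evf evM.
pose ev := linfun evl.
have evE f : ev f = f x0 by rewrite lfunE.
have <- : \dim {: stalk A (val x0)} = m.
  by case: Aloc => + _; apply; apply: faces_nonempty (valP x0).
rewrite -(limg_ker_dim ev) (_ : (lker (coboundary A 0) :&: lker ev)%VS = 0%VS).
  by rewrite dimv0 dimvS // subvf.
apply/eqP; rewrite -subv0; apply/subvP => f; rewrite memv_cap !memv_ker memv0.
move=> /andP [/eqP df0 /eqP fx0].
have f0 v : [set v] \in X -> cochain_at f [set v] = 0.
  move=> vX; have /connectP [s] := Xconn v0X vX.
  have : cochain_at f [set v0] = 0.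
    by have /= -> := cochain_at_val f x0; rewrite -evE.
  elim: s (v0) => [|u s IH] w fw /=; first by move=> _ ->.
  move=> /andP [/andP [wu wuX] pth] lst; apply: (IH u) => //.
  have := coboundary0_edge df0 wu wuX; rewrite fw linear0 => /esym/eqP.
  rewrite (res_eq0 Aloc) => [/eqP //||//|].
    by apply: (vertex_nonempty Xcl (v := w)); rewrite setUC.
  by rewrite setUC vertex_proper // eq_sym.
apply/eqP/dprodvP => x; rewrite dprodv0E -cochain_at_val.
have := valP x; rewrite inE => /andP [xX /cards1P [v xv]].
by rewrite xv in xX *; exact: f0.
Qed.

Lemma dim_cocycles v0 : [set v0] \in X ->
  (#|faces X 0| * m <= \dim (cocycles A 1) + m)%N.
Proof.
move=> v0X; rewrite -(@dim_cochain A 0 m); last first.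
  by move=> x; case: Aloc => + _; apply; apply: faces_nonempty (valP x).
rewrite -(limg_ker_dim (coboundary A 0)) capfv addnC leq_add ?(dim_constant_sections v0X) //.
apply: dimvS; apply/subvP => g /memv_imgP [f _ ->]; exact: coboundary_cocycle.
Qed.

(** Inside the 1-cochains of [A], cocycles of the subsheaf contain the intersection of its cochains
    with the cocycles of [A], and an intersection loses at most the ambient dimension
    [#|faces X 1| * m]. The additive form avoids truncated subtraction. *)
Lemma dim_subsheaf_cocycles (B : subsheaf A) v0 : [set v0] \in X ->
  (\dim {: cochain (sheaf_of_subsheaf B) 1} + #|faces X 0| * m <=
   \dim (cocycles (sheaf_of_subsheaf B) 1) + m + #|faces X 1| * m)%N.
Proof.
move=> v0X; set i := incl_cochain B 1.
have i0 := incl_cochain_inj B 1.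
have dimi (W : {vspace cochain (sheaf_of_subsheaf B) 1}) : \dim (i @: W) = \dim W.
  by apply: limg_dim_eq; rewrite (eqP i0) capv0.
have capZ : (limg i :&: cocycles A 1 <= i @: cocycles (sheaf_of_subsheaf B) 1)%VS.
  apply/subvP => g; rewrite memv_cap => /andP [/memv_imgP [f _ ->]].
  by rewrite incl_cochain_cocycle; exact: memv_img.
have := dimv_sum_cap (limg i) (cocycles A 1).
have := dimvS capZ; rewrite !dimi => h1 h2.
have h3 : (\dim (limg i + cocycles A 1)%VS <= #|faces X 1| * m)%N.
  rewrite -(@dim_cochain A 1 m); first by rewrite dimvS // subvf.
  by move=> x; case: Aloc => + _; apply; apply: faces_nonempty (valP x).
have h4 := dim_cocycles v0X.
move: h1 h2 h3 h4; lia.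
Qed.

End CocycleRate.

Lemma complex_vertex (V : finType) (X : {set {set V}}) d : d_complex d X ->
  exists v, [set v] \in X.
Proof.
case=> X0 Xcl Xd; have [y yX /andP [/eqP yd _]] := Xd _ X0.
have /card_gt0P [v vy] : (0 < #|y|)%N by rewrite yd.
by exists v; apply: Xcl yX _; rewrite sub1set.
Qed.

Lemma handshake (R : realType) (V : finType) (X : {set {set V}}) d Q :
  d_complex d X -> (forall v, v \in faces X 0 -> #|cofaces X 1 v| = Q) ->
  (#|faces X 0| * Q)%:R = 2 * #|faces X 1|%:R :> R.
Proof.
move=> [_ Xcl _] XQ.
have := sum_ordered_edges X (fun=> 1 : R); rewrite [in RHS]sumr_const => <-.
transitivity (\sum_(v | [set v] \in faces X 0) Q%:R : R).
  rewrite -(big_vertices X (fun=> Q%:R : R)) sumr_const -mulrnA mulnC.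
  by congr (_ * _)%:R; rewrite card_sig; exact: eq_card.
rewrite big_mkcond; apply: eq_bigr => v _.
transitivity (#|[set u | [set v; u] \in faces X 1]|%:R : R); last first.
  by rewrite -sum1dep_card natr_sum.
rewrite card_edges_at; case: ifPn => [/XQ -> //|vX].
suff -> : cofaces X 1 [set v] = set0 by rewrite cards0.
apply/setP => x; rewrite !inE; apply: contraNF vX => /andP [/andP [xX _] vx].
by rewrite inE cards1 (Xcl _ _ xX vx).
Qed.

(** * Choice of constants, and passage from cocycles to codewords *)

Unset Implicit Arguments.
Set Strict Implicit.

Theorem theorem9p11 (R : realType) (Q r m D : nat) (lambda kappa : R)
  (hlambda : -1 <= lambda <= 1) (hkappa : 1 <= kappa <= 2)
  (hrm : (0 < r < m)%N)
  (hQ : kappa / Q%:R < r%:R / m%:R :> R) (hQ2 : r%:R / m%:R < 2 / Q%:R :> R)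
  (hexp : lambda <= Num.min
     (1 / 6 * (1 / 4 * (1 - lambda) * (1 - (kappa / Q%:R) / (r%:R / m%:R))
               - lambda) ^+ 2 * (1 - lambda))
     (1 / 4 * (1 - lambda) * (1 - (kappa / Q%:R) / (r%:R / m%:R)))) :
  exists2 delta : R, 0 < delta &
  forall (d : nat) (disp : Order.disp_t) (V : finOrderType disp)
    (X : {set {set V}}),
  (2 <= d)%N -> d_complex d X -> connected_complex X -> maxdeg d X = D ->
  (forall v, v \in faces X 0 -> #|cofaces X 1 v| = Q) ->
  (forall v, v \in faces X 0 ->
     spectral_expander d.-1 (link X v) (-1) lambda) ->
  (forall e e', e \in faces X 1 -> e' \in faces X 1 -> e :&: e' != set0 ->
     kappa^-1 * weight R d X e <= weight R d X e' <= kappa * weight R d X e) ->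
  forall (F : finFieldType) (A : sheaf F X) (U : forall e, {vspace stalk A e}),
  locally_constant A m ->
  (forall e, e \in faces X 1 -> \dim (U e) = (m - r)%N) ->
  (forall v (S : {set {set V}}), v \in faces X 0 -> S \subset cofaces X 1 v ->
     (m <= #|S| * r)%N -> (\bigcap_(e in S) (res A v e @^-1: U e))%VS = 0%VS) ->
  let G := sheaf_of_subsheaf (edge_subsheaf U) in
  (forall iota : forall e : face X 1, 'Hom(stalk G (val e), 'rV[F]_(m - r)),
     (forall e, bijective (iota e)) ->
     delta <= relative_distance R (cocycle_code iota)) /\
  2 / Q%:R - r%:R / m%:R - #|faces X 1|%:R^-1 <= cocycle_rate G R 1.
Proof.
have /andP [r0 rm] := hrm; have m0 : (0 < m)%N by exact: ltn_trans rm.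
have kappa0 : 0 < kappa by have /andP [k1 _] := hkappa; exact: lt_le_trans k1.
have rR : 0 < r%:R :> R by rewrite ltr0n.
have mR : 0 < m%:R :> R by rewrite ltr0n.
(* For [Q = 0] the convention for inverses makes [2 / Q] zero, contradicting [hQ2]. *)
have Q0 : (0 < Q)%N.
  rewrite lt0n; apply: contraTneq hQ2 => ->; rewrite invr0 mulr0 -leNgt.
  by rewrite divr_ge0.
have QR : 0 < Q%:R :> R by rewrite ltr0n.
set p := (kappa / Q%:R) / (r%:R / m%:R) in hexp.
have p1 : p < 1 by rewrite ltr_pdivrMr ?divr_gt0 // mul1r.
(* The Rayleigh and trickling arguments need a nonnegative bound; raising a negative [lambda] to 0
   only weakens the expansion hypothesis. *)
pose la := Num.max lambda 0.
pose eps := (1 - la) * (1 - p); pose eta := eps / 4 - la.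
have [la01 eta0 laeta] : [/\ 0 <= la < 1, 0 < eta & la / (1 - la) <= eta ^+ 2 / 6].
  move: hexp; rewrite le_min => /andP [h1 h2]; rewrite /eta /eps /la.
  case: (lerP lambda 0) => l0.
    rewrite lexx ltr01 !subr0 mul0r mul1r; split=> //; first by lra.
    by rewrite mulr_ge0 ?sqr_ge0 // invr_ge0.
  have l1 : lambda < 1.
    rewrite lt_neqAle; have /andP [_ ->] := hlambda; rewrite andbT.
    by apply: contraTneq h2 => ->; rewrite subrr mulr0 mul0r -ltNge ltr01.
  have l1' : 0 < 1 - lambda by rewrite subr_gt0.
  have E : 1 / 4 * (1 - lambda) * (1 - p) = (1 - lambda) * (1 - p) / 4 by ring.
  rewrite E in h1 h2; split; first by rewrite ltW.
    (* The second term of the minimum gives [eta >= 0]; if [eta] were 0, the first would force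
       [lambda <= 0]. *)
    rewrite lt_def subr_ge0 h2 andbT; apply/eqP => e0.
    by move: h1; rewrite e0 expr0n mulr0 mul0r leNgt l0.
  by rewrite ler_pdivrMr //; move: h1; lra.
pose K := 5 / 24 * eps * eta ^+ 2.
have /andP [la0 la1] := la01.
have eps0 : 0 < eps by rewrite mulr_gt0 // subr_gt0.
have K0 : 0 < K by rewrite mulr_gt0 ?exprn_gt0 // mulr_gt0 //; lra.
(* The 1 accounts for the default value of [relative_distance], and [D.+1] keeps the denominator
   positive for every [D]. *)
exists (Num.min 1 (K / D.+1%:R)).
  by rewrite lt_min ltr01 divr_gt0 // ltr0n.
move=> d disp V X d2 Xd Xconn XD XQ Xexp Xbal F A U Aloc dimU genpos G.
have Xcl := sub_face Xd; have [v0 v0X] := complex_vertex Xd.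
have v0X0 : [set v0] \in faces X 0 by rewrite inE v0X cards1.
have X1 : (0 < #|faces X 1|)%N.
  have : (0 < #|cofaces X 1 [set v0]|)%N by rewrite XQ.
  by move=> /leq_trans; apply; apply: subset_leq_card; apply/subsetP => x; rewrite inE => /andP [].
have X1R : 0 < #|faces X 1|%:R :> R by rewrite ltr0n.
have edgeU (e : face X 1) : edge_subspace U (val e) = U (val e).
  by have := valP e; rewrite inE /edge_subspace => /andP [_ /eqP ->].
split=> [iota iota_bij|].
  rewrite /relative_distance; apply/bigmin_geP; split; first by rewrite ge_min lexx.
  move=> w /andP [/memv_imgP [f fZ ->] w0].
  have cardface : #|face X 1| = #|faces X 1| by rewrite card_sig; exact: eq_card.
  pose g := incl_cochain (edge_subsheaf U) 1 f.
  have gZ : g \in cocycles A 1 by rewrite incl_cochain_cocycle.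
  have gU (x : face X 1) : g x \in U (val x).
    by rewrite incl_cochainE -edgeU; exact: subvsP.
  have g0 : g != 0.
    apply: contra w0 => /eqP g0; apply/eqP/ffunP => x; rewrite lfunE !ffunE.
    suff -> : f x = 0 by rewrite linear0.
    by apply: subvs_inj; rewrite -incl_cochainE -/g g0 dprodv0E linear0.
  have bal e e' : e \in faces X 1 -> e' \in faces X 1 -> e :&: e' != set0 ->
      weight R d X e' <= kappa * weight R d X e.
    by move=> eX eX' ee; have /andP [] := Xbal e e' eX eX' ee.
  have exp v : v \in faces X 0 -> spectral_expander d.-1 (link X v) (-1) la.
    move=> vX a h h0 hs hE; have /andP [-> al] := Xexp v vX a h h0 hs hE.
    by rewrite le_max al.
  have := cocycle_support_bound d2 Xd Xconn XQ kappa0 bal Q0 r0 m0 Aloc genpos gZ gU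
    la01 p1 exp erefl eta0 laeta g0.
  rewrite -/p -/eps -/K XD cardface => hK.
  (* Identifications and the inclusion into [A] are injective, so the codeword and the cocycle [g]
     have the same support. *)
  have -> : [set i | linfun (identify iota) f i != 0] = [set x | g x != 0].
    apply/setP => x; rewrite !inE lfunE ffunE incl_cochainE.
    have inj := bij_inj (iota_bij x).
    have -> : (iota x (f x) == 0) = (f x == 0) by rewrite -(inj_eq inj) linear0.
    by rewrite -(inj_eq (@subvs_inj _ _ _)) linear0.
  rewrite ge_min; apply/orP; right.
  rewrite ler_pdivrMr ?ltr0n // mulrAC ler_pdivlMr // -[leRHS]mulrC.
  apply: le_trans hK _; rewrite ler_wpM2r // ler_nat //.
have dimG : \dim {: cochain G 1} = (#|faces X 1| * (m - r))%N.
  apply: dim_cochain => x; rewrite dimvf /= -[RHS](dimU _ (valP x)) -edgeU; reflexivity.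
have := dim_subsheaf_cocycles Xcl Xconn Aloc (edge_subsheaf U) v0X.
rewrite /cocycle_rate -/G dimG -(ler_nat R) !natrD !natrM natrB ?(ltnW rm) // => hz.
have hs := handshake R Xd XQ; rewrite natrM in hs.
set b := #|faces X 1|%:R in X1R hz hs *; set z := (\dim _)%:R in hz *.
have rmR : 0 < m%:R - r%:R :> R by rewrite subr_gt0 ltr_nat.
rewrite ler_pdivlMr ?mulr_gt0 //.
have aE : #|faces X 0|%:R = 2 * b / Q%:R by rewrite -hs mulfK // gt_eqF.
set L := _ - _ - _.
have hL : b * m%:R * L <= z.
  have -> : b * m%:R * L = #|faces X 0|%:R * m%:R - b * r%:R - m%:R.
    by rewrite aE /L; field; rewrite !gt_eqF.
  lra.
(* The count [hL] has [b * m] where the rate has the smaller [b * (m - r)]. The replacement is valid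
   for positive [L]; otherwise the claim is trivial. *)
have [L0|L0] := lerP L 0.
  have bm0 : 0 <= b * (m%:R - r%:R) by rewrite ltW // mulr_gt0.
  by apply: (@le_trans _ _ 0); [exact: mulr_le0_ge0 | exact: ler0n].
apply: le_trans hL; rewrite mulrC ler_pM2r // ler_pM2l //; lra.
Qed.
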